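(* Let $\mathbf V\times Q$ be the multi-patch generalized (isogeometric) Taylor--Hood space. Then $$\sup_{\mathbf u\in\mathbf V}\frac{(\nabla\cdot\mathbf u,p)_{L^2(\Omega)}}{|\mathbf u|_{H^1(\Omega)}}\ \ge\ \frac{\beta\,\min_{k=1,\ldots,K}\beta_k}{3\,c_F\,\delta}\,\|p\|_{L^2(\Omega)}\qquad\text{for all } p\in Q,$$ where $\beta$ is the inf-sup constant of the continuous problem, $\beta_k$ are the patch-local discrete inf-sup constants, $\delta$ is the boundedness constant of the divergence form and $c_F$ is the stability constant of the Fortin operator.
   Context: **Geometry.** $\Omega\subset\mathbb R^2$ is an open bounded (connected) domain with Lipschitz boundary, composed of $K$ pairwise disjoint open bounded Lipschitz patches $\Omega^{(k)}$ with $\overline\Omega=\bigcup_k\overline{\Omega^{(k)}}$. Each patch is $\Omega^{(k)}=\mathbf G_k(\widehat\Omega)$, $\widehat\Omega=(0,1)^2$, where $\mathbf G_k$ extends continuously to the closure; edges and vertices of a patch are the images of the sides and corners of the unit square. $H_k$ is the diameter of $\Omega^{(k)}$ and $\mathbf n^{(k)}$ its outer unit normal. $\mathcal N_\Gamma(k)$ is the set of indices $\ell$ of patches sharing an edge with $\Omega^{(k)}$; this edge is $\Gamma^{(k,\ell)}=\partial\Omega^{(k)}\cap\partial\Omega^{(\ell)}$ (interface). $x_1,\dots,x_J$ are the common vertices of two or more patches not lying on $\partial\Omega$, and $\mathcal N_x(j)=\{k: x_j\in\partial\Omega^{(k)}\}$. Standing assumptions: (1) for $k\ne\ell$, $\partial\Omega^{(k)}\cap\partial\Omega^{(\ell)}$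 is a common edge, a common vertex, or empty; (2) $|\mathcal N_x(j)|\le C_2$ for all $j$; (3) $\|\nabla\mathbf G_k\|_{L^\infty(\widehat\Omega)}\le C_3H_k$ and $\|\nabla\mathbf G_k^{-1}\|_{L^\infty}\le C_3H_k^{-1}$ for all $k$; (4) there is $C_4>0$ such that on each interface there is a point $\overline x^{(k,\ell)}=\overline x^{(\ell,k)}\in\Gamma^{(k,\ell)}$ with $\mathbf n^{(k)}(\overline x^{(k,\ell)})\cdot\mathbf n^{(k)}(x)\ge C_4$ for all $x\in\Gamma^{(k,\ell)}$. **Discretization.** Fix a degree $\mathfrak p\in\{1,2,\dots\}$ and smoothness $\mathfrak s\in\{0,\dots,\mathfrak p-1\}$. For each patch $k$ and direction $d\in\{1,2\}$ choose breakpoints $0=\zeta^{(k,d)}_0<\dots<\zeta^{(k,d)}_{N^{(k,d)}}=1$. For a degree $r$, $S^{(k,r,\mathfrak s)}$ is the tensor product over $d=1,2$ of the spaces of $C^{\mathfrak s}$ functions on $(0,1)$ that are polynomials of degree at most $r$ on each interval $(\zeta^{(k,d)}_{i-1},\zeta^{(k,d)}_i)$, with the tensor-product B-spline basis. Let $\widehat h_k$ and $\widehat h_{k,\min}$ be the largest and smallest breakpoint spacing (over $i$ and $d$) and $h_k=H_k\widehat h_k$; (5) $C_5\widehat h_k\le\widehat h_{k,\min}$ for all $k$, with $C_5>0$. Let $\Gamma_D^{(k)}=\partial\Omega^{(k)}\cap\partial\Omega$, and $$\mathbf V^{(k)}=\{\mathbf v:\ \mathbf v\circ\mathbf G_k\in[S^{(k,\mathfrak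 p+1,\mathfrak s)}]^2,\ \mathbf v|_{\Gamma_D^{(k)}}=0\},\qquad Q^{(k)}=\{q:\ q\circ\mathbf G_k\in S^{(k,\mathfrak p,\mathfrak s)}\},$$ with bases given by the images under $\mathbf G_k$ of the tensor-product B-spline basis functions (for $\mathbf V^{(k)}$: those vanishing on the preimage of $\Gamma_D^{(k)}$). (6) (Fully matching) For every interface $\Gamma^{(k,\ell)}$ and every basis function of $\mathbf V^{(k)}$ having support on $\Gamma^{(k,\ell)}$ there is exactly one basis function of $\mathbf V^{(\ell)}$ that agrees with it on $\Gamma^{(k,\ell)}$. The global spaces are $$\mathbf V=\{\mathbf v\in[H^1_0(\Omega)]^2:\ \mathbf v|_{\Omega^{(k)}}\in\mathbf V^{(k)}\ \forall k\},\qquad Q=\{q\in L^2_0(\Omega):\ q|_{\Omega^{(k)}}\in Q^{(k)}\ \forall k\}.$$ Here $L^2_0$ denotes $L^2$ functions with zero mean, and $|\cdot|_{H^1}$ is the seminorm $\|\nabla\cdot\|_{L^2}$. $Q_1=\{q_1\in L^2_0(\Omega): q_1|_{\Omega^{(k)}}\text{ constant for all }k\}$. Suprema of quotients are over nonzero arguments. **Constants.** $\beta>0$ satisfies $\sup_{\mathbf u\in[H^1_0(\Omega)]^2}(\nabla\cdot\mathbf u,p)_{L^2(\Omega)}/\|\mathbf u\|_{H^1(\Omega)}\ge\beta\|p\|_{L^2(\Omega)}$ for all $p\in L^2_0(\Omega)$. $\beta_k>0$ satisfies $\sup_{\mathbf u\in\mathbf V^{(k)}\cap[H^1_0(\Omega^{(k)})]^2}(\nabla\cdot\mathbf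 u,p)_{L^2(\Omega^{(k)})}/|\mathbf u|_{H^1(\Omega^{(k)})}\ge\beta_k\|p\|_{L^2(\Omega^{(k)})}$ for all $p\in Q^{(k)}\cap L^2_0(\Omega^{(k)})$. $\delta=\sqrt2$ is the constant in the boundedness of the divergence form, $(\nabla\cdot\mathbf u,p)_{L^2}\le\delta|\mathbf u|_{H^1}\|p\|_{L^2}$; one has $\beta\le\delta$, $\beta_k\le\delta$. $c_F\ge1$ is a constant, depending only on $C_2,C_3,C_4$, for which there is an operator $\mathbf\Pi_F:[H^1_0(\Omega)]^2\to\mathbf V$ with $|\mathbf\Pi_F\mathbf u|_{H^1(\Omega)}\le c_F|\mathbf u|_{H^1(\Omega)}$ and $(\nabla\cdot(I-\mathbf\Pi_F)\mathbf u,p_1)_{L^2(\Omega)}=0$ for all $\mathbf u\in[H^1_0(\Omega)]^2$, $p_1\in Q_1$. *)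

(* Defs.v *)
From mathcomp Require Import all_boot all_order all_algebra.
From mathcomp Require Import all_classical all_reals all_analysis.
Set Implicit Arguments.
Unset Strict Implicit.
Unset Printing Implicit Defensive.
Import Order.TTheory GRing.Theory Num.Theory.
Import numFieldNormedType.Exports.
Local Open Scope classical_set_scope.
Local Open Scope ring_scope.

(* The plane is [R * R].  Its library norm is the sup norm, which is used only
   through the topology and boundedness; lengths and angles go through [edot] and [enorm]. *)
Notation plane R := (R * R)%type.
Notation leb2 R := ((@lebesgue_measure R) \x (@lebesgue_measure R))%E.

Section Plane.
Context {R : realType}.
Implicit Types (D : set (plane R)) (x y a : plane R).

Definition coord (d : 'I_2) (a : plane R) : R := if d == ord0 then a.1 else a.2.

Definition evec (d : 'I_2) : plane R := ((d == 0 :> nat)%:R, (d == 1 :> nat)%:R).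

Definition edot (x y : plane R) : R := x.1 * y.1 + x.2 * y.2.

Definition enorm (x : plane R) : R := Num.sqrt (edot x x).

Definition diameter D : R := sup [set enorm (x - y) | x in D & y in D].

Definition boundary D : set (plane R) := closure D `\` interior D.

Definition osquare : set (plane R) := [set a | 0 < a.1 < 1 /\ 0 < a.2 < 1].

Definition csquare : set (plane R) := [set a | 0 <= a.1 <= 1 /\ 0 <= a.2 <= 1].

Definition side (d : 'I_2) (e : bool) : set (plane R) :=
  csquare `&` [set a | coord d a = e%:R].

Definition corner (e : bool * bool) : plane R := (e.1%:R, e.2%:R).

(* Near each boundary point, in suitable orthonormal coordinates, [D] is the
   subgraph of a Lipschitz function. *)
Definition lipschitz_boundary D : Prop :=
  forall x0, boundary D x0 ->
  exists (t n : plane R) (r h L : R) (gam : R -> R),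
    [/\ edot t t = 1, edot n n = 1 & edot t n = 0] /\
    [/\ 0 < r, 0 < h,
        forall s, `|s| < r -> `|gam s| < h,
        forall s s', `|s| < r -> `|s'| < r -> `|gam s - gam s'| <= L * `|s - s'|
      & forall s tau, `|s| < r -> `|tau| < h ->
          (D (x0 + s *: t + tau *: n) <-> tau < gam s)].

(* [n] is the outer unit normal of [D] at [x]: up to a relative error tending to
   0, [D] is near [x] the half plane [(y - x) . n < 0].  For Lipschitz [D] this
   is differentiability at [x] of the local graph; it holds for at most one [n],
   for almost every boundary point [x], and for no [n] at a genuine corner. *)
Definition outer_normal D x (n : plane R) : Prop :=
  edot n n = 1 /\
  forall eps : R, 0 < eps ->
    \forall y \near x,
      (eps * enorm (y - x) < edot (y - x) n -> ~ D y) /\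
      (edot (y - x) n < - (eps * enorm (y - x)) -> D y).

End Plane.

Section FunctionSpaces.
Context {R : realType}.
Implicit Types (D : set (plane R)) (f g p q : plane R -> R).

(* Functions on [D] are total functions on the plane of which only the values on
   [D] matter; classes modulo almost everywhere equality are not formed, and the
   spaces below are all closed under [ae_eq (leb2 R) D]. *)
Definition L2 D f : Prop := (f \_ D) \in Lfun (leb2 R) 2%:E.

Definition L2norm D f : R := fine ('N[leb2 R]_2%:E[EFin \o (f \_ D)])%E.

Definition L2ip D f g : R := \int[leb2 R]_(x in D) (f x * g x).

Definition L20 D f : Prop := L2 D f /\ \int[leb2 R]_(x in D) f x = 0.

Fixpoint Ck (n : nat) f : Prop :=
  if n is m.+1 then
    [/\ continuous f, forall (j : 'I_2) x, derivable f x (evec j)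
      & forall j : 'I_2, Ck m ('D_(evec j) f)]
  else continuous f.

Definition test_fun D f : Prop :=
  (forall n, Ck n f) /\
  exists A : set (plane R),
    [/\ compact A, A `<=` D & forall x, ~ A x -> f x = 0].

Definition weak_partial D (j : 'I_2) f g : Prop :=
  forall phi, test_fun D phi -> L2ip D f ('D_(evec j) phi) = - L2ip D g phi.

(* A Sobolev function is carried together with a representative of its weak
   gradient, which is unique up to almost everywhere equality. *)
Record sobfun := Sobfun {
  sval : plane R -> R;
  sgrad : 'I_2 -> plane R -> R }.

Definition H1 D (u : sobfun) : Prop :=
  L2 D (sval u) /\
  forall j, L2 D (sgrad u j) /\ weak_partial D j (sval u) (sgrad u j).

(* The closure in H^1 of the smooth functions with compact support in [D]. *)
Definition H10 D (u : sobfun) : Prop :=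
  H1 D u /\
  exists phi : nat -> plane R -> R,
    [/\ forall n, test_fun D (phi n),
        L2norm D (phi n \- sval u) @[n --> \oo] --> (0 : R)
      & forall j, L2norm D ('D_(evec j) (phi n) \- sgrad u j) @[n --> \oo]
                    --> (0 : R)].

Definition vfield := 'I_2 -> sobfun.

Definition vH10 D (u : vfield) : Prop := forall c, H10 D (u c).

Definition veq D (u v : vfield) : Prop :=
  forall c, ae_eq (leb2 R) D (sval (u c)) (sval (v c)).

Definition vnull D (u : vfield) : Prop :=
  forall c, ae_eq (leb2 R) D (sval (u c)) (cst 0).

Definition vsub (u v : vfield) : vfield := fun c =>
  Sobfun (sval (u c) \- sval (v c)) (fun j => sgrad (u c) j \- sgrad (v c) j).

Definition divg (u : vfield) : plane R -> R := fun x => \sum_(c < 2) sgrad (u c) c x.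

Definition H1semi D (u : vfield) : R :=
  Num.sqrt (\sum_(c < 2) \sum_(j < 2) L2norm D (sgrad (u c) j) ^+ 2).

Definition H1norm D (u : vfield) : R :=
  Num.sqrt (\sum_(c < 2) L2norm D (sval (u c)) ^+ 2 + H1semi D u ^+ 2).

(* [sup (div u, p) / nrm u] over the [u] in [W] that are not zero on [D]. *)
Definition div_sup D (W : set vfield) (nrm : vfield -> R) p : \bar R :=
  ereal_sup [set (L2ip D (divg u) p / nrm u)%:E | u in W `&` [set u | ~ vnull D u]].

(* The weak gradient of [F] on [D] exists and the L^oo norm of its (Frobenius)
   norm is at most [M]. *)
Definition grad_bounded D (F : plane R -> plane R) (M : R) : Prop :=
  exists u : vfield,
    [/\ forall c, H1 D (u c),
        forall c x, D x -> sval (u c) x = coord c (F x)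
      & ('N[leb2 R]_+oo[EFin \o
           ((fun x => Num.sqrt (\sum_(c < 2) \sum_(j < 2) sgrad (u c) j x ^+ 2))
              \_ D)] <= M%:E)%E].

End FunctionSpaces.

Section Geometry.
Context {R : realType} {K : nat}.
Variables (Om : set (plane R)) (G : 'I_K -> plane R -> plane R).

(* [G k] is used on the closed square only. *)
Definition subdom k : set (plane R) := G k @` osquare.

Definition edge k (d : 'I_2) (e : bool) : set (plane R) := G k @` side d e.

Definition vertex k (e : bool * bool) : plane R := G k (corner e).

Definition multipatch_domain : Prop :=
  [/\ open Om, bounded_set Om, connected Om, Om !=set0 & lipschitz_boundary Om] /\
  [/\ forall k, {within csquare, continuous (G k)},
      forall k a b, osquare a -> osquare b -> G k a = G k b -> a = b,
      forall k, [/\ open (subdom k), bounded_set (subdom k),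
                    lipschitz_boundary (subdom k) & subdom k `<=` Om],
      forall k l, k != l -> subdom k `&` subdom l = set0
    & closure Om = \bigcup_k closure (subdom k)].

Definition interface k l : set (plane R) := boundary (subdom k) `&` boundary (subdom l).

Definition share_edge k l : Prop :=
  k != l /\ exists d e d' e', interface k l = edge k d e /\ interface k l = edge l d' e'.

Definition no_hanging_vertices : Prop :=
  forall k l, k != l ->
    [\/ share_edge k l,
        exists e e', interface k l = [set vertex k e] /\ vertex k e = vertex l e'
      | interface k l = set0].

Definition interior_vertex (x : plane R) : Prop :=
  ~ boundary Om x /\
  exists k l e e', [/\ k != l, x = vertex k e & x = vertex l e'].

Definition bounded_valence (C2 : R) : Prop :=
  forall x, interior_vertex x ->
    #|[set k : 'I_K | `[< boundary (subdom k) x >]]%SET|%:R <= C2.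

Definition regular_maps (C3 : R) : Prop :=
  forall k,
    grad_bounded osquare (G k) (C3 * diameter (subdom k)) /\
    exists2 Ginv : plane R -> plane R,
      forall a, osquare a -> Ginv (G k a) = a
    & grad_bounded (subdom k) Ginv (C3 / diameter (subdom k)).

(* The normal exists only almost everywhere on an interface (in particular not
   at its end points, when these are corners), so [x] ranges over the points of
   the interface that have one. *)
Definition normals_aligned (C4 : R) : Prop :=
  exists xbar : 'I_K -> 'I_K -> plane R,
  forall k l, share_edge k l ->
    [/\ interface k l (xbar k l), xbar k l = xbar l k
      & exists2 nbar, outer_normal (subdom k) (xbar k l) nbar
          & forall x n, interface k l x -> outer_normal (subdom k) x n ->
              C4 <= edot nbar n].

End Geometry.

Section Splines.
Context {R : realType}.

Definition breakpoints (N : nat) (z : nat -> R) : Prop :=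
  [/\ (0 < N)%N, z 0%N = 0, z N = 1 & forall i, (i < N)%N -> z i < z i.+1].

(* C^s functions on the open unit interval, extended continuously to [0, 1], that
   are piecewise polynomial of degree at most [r]. *)
Definition spline1 (N : nat) (z : nat -> R) (r s : nat) (f : R -> R) : Prop :=
  [/\ {within [set t | 0 <= t <= 1], continuous f},
      forall j t, (j < s)%N -> 0 < t < 1 -> derivable (derive1n j f) t 1,
      forall j t, (j <= s)%N -> 0 < t < 1 -> {for t, continuous (derive1n j f)}
    & forall i, (i < N)%N -> exists2 P : {poly R}, (size P <= r.+1)%N
        & forall t, z i < t < z i.+1 -> f t = P.[t]].

(* The span of the products of univariate splines, on the closed unit square. *)
Definition spline2 (N : 'I_2 -> nat) (z : 'I_2 -> nat -> R) (r s : nat)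
    (F : plane R -> R) : Prop :=
  exists (m : nat) (f : 'I_m -> 'I_2 -> R -> R),
    (forall i d, spline1 (N d) (z d) r s (f i d)) /\
    forall a, csquare a -> F a = \sum_(i < m) \prod_(d < 2) f i d (coord d a).

(* The open knot vector of degree [r] with interior multiplicities [r - s]. *)
Definition knots (N : nat) (z : nat -> R) (r s : nat) : seq R :=
  nseq r.+1 (z 0%N) ++ flatten [seq nseq (r - s) (z i) | i <- iota 1 N.-1] ++
  nseq r.+1 (z N).

(* Cox-de Boor recursion; [x / 0 = 0] is the convention usual there.  The last
   nonempty knot interval is closed on the right, so that the functions are
   continuous at the right end point. *)
Fixpoint cox_de_boor (xi : seq R) (r i : nat) (t : R) : R :=
  if r is q.+1 then
    (t - xi`_i) / (xi`_(i + q.+1) - xi`_i) * cox_de_boor xi q i t +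
    (xi`_(i + q.+2) - t) / (xi`_(i + q.+2) - xi`_i.+1) * cox_de_boor xi q i.+1 t
  else ((xi`_i <= t < xi`_i.+1) ||
        [&& xi`_i < xi`_i.+1, xi`_i.+1 == last 0 xi & t == last 0 xi])%:R.

Definition nbspline (N : nat) (z : nat -> R) (r s : nat) : nat :=
  (size (knots N z r s) - r.+1)%N.

Definition bspline (N : nat) (z : nat -> R) (r s i : nat) : R -> R :=
  cox_de_boor (knots N z r s) r i.

End Splines.

Section TaylorHood.
Context {R : realType} {K : nat}.
Variables (Om : set (plane R)) (G : 'I_K -> plane R -> plane R).
Variables (deg smo : nat).
Variables (N : 'I_K -> 'I_2 -> nat) (zeta : 'I_K -> 'I_2 -> nat -> R).

Definition spacings k : set R :=
  [set h | exists d i, (i < N k d)%N /\ h = zeta k d i.+1 - zeta k d i].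

Definition quasi_uniform (C5 : R) : Prop :=
  forall k, C5 * sup (spacings k) <= inf (spacings k).

(* [v] agrees almost everywhere on the patch with a function whose pullback is
   [F]. *)
Definition pullback_is k (v F : plane R -> R) : Prop :=
  exists2 w, ae_eq (leb2 R) (subdom G k) v w
    & forall a, osquare a -> w (G k a) = F a.

(* The trace on the Dirichlet part of the patch boundary is read off the pullback
   [F], which is continuous on the closed square. *)
Definition Vloc k (v : vfield) : Prop :=
  forall c : 'I_2, exists F : plane R -> R,
    [/\ spline2 (N k) (zeta k) deg.+1 smo F,
        pullback_is k (sval (v c)) F
      & forall a, csquare a ->
          (boundary (subdom G k) `&` boundary Om) (G k a) -> F a = 0].

Definition Qloc k (q : plane R -> R) : Prop :=
  exists2 F : plane R -> R, spline2 (N k) (zeta k) deg smo F & pullback_is k q F.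

Definition Vglob (v : vfield) : Prop := vH10 Om v /\ forall k, Vloc k v.

Definition Qglob (q : plane R -> R) : Prop := L20 Om q /\ forall k, Qloc k q.

Definition Q1 (q : plane R -> R) : Prop :=
  L20 Om q /\ forall k, exists c : R, ae_eq (leb2 R) (subdom G k) q (cst c).

(* A basis function of the velocity space is indexed by its component [c] and the
   indices [i 0], [i 1] of its univariate factors. *)
Definition Vindex : Type := ('I_2 * {ffun 'I_2 -> nat})%type.

Definition Vbasis_pull k (b : Vindex) (a : plane R) : plane R :=
  (\prod_(d < 2) bspline (N k d) (zeta k d) deg.+1 smo (b.2 d) (coord d a))
    *: evec b.1.

Definition is_Vindex k (b : Vindex) : Prop :=
  (forall d, (b.2 d < nbspline (N k d) (zeta k d) deg.+1 smo)%N) /\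
  forall a, csquare a -> (boundary (subdom G k) `&` boundary Om) (G k a) ->
    Vbasis_pull k b a = 0.

Definition fully_matching : Prop :=
  forall k l, share_edge G k l -> forall b, is_Vindex k b ->
    (exists a, [/\ csquare a, interface G k l (G k a) & Vbasis_pull k b a != 0]) ->
    exists! b', is_Vindex l b' /\
      forall a a', csquare a -> csquare a' -> G k a = G l a' ->
        interface G k l (G k a) -> Vbasis_pull k b a = Vbasis_pull l b' a'.

(* The operator acts on classes modulo almost everywhere equality. *)
Definition fortin_operator (cF : R) (PiF : vfield -> vfield) : Prop :=
  (forall u v, vH10 Om u -> vH10 Om v -> veq Om u v -> veq Om (PiF u) (PiF v)) /\
  forall u, vH10 Om u ->
    [/\ Vglob (PiF u),
        H1semi Om (PiF u) <= cF * H1semi Om u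
      & forall p1, Q1 p1 -> L2ip Om (divg (vsub u (PiF u))) p1 = 0].

End TaylorHood.

(* Main.v *)
Require Import Defs.
From mathcomp Require Import all_boot all_order all_algebra.
From mathcomp Require Import all_classical all_reals all_analysis.
From mathcomp Require Import measurable_realfun ring lra.
Import Order.TTheory GRing.Theory Num.Theory.
Import numFieldNormedType.Exports.
Local Open Scope classical_set_scope.
Local Open Scope ring_scope.

(** Split the pressure as [p = p0 + p1], where [p1] is on each patch the mean of
[p] there, and write [a = |p0|], [b = |p1|], [S] for the supremum to be bounded
below and [Bm] for the smallest patch constant.

The fluctuation [p0] has mean 0 on every patch and is still a spline there, so
the local inf-sup conditions apply to it. The local near-maximisers, scaled so
that their seminorms are the norms of [p0] on the patches, are extended by zero
and added up ([glue]). Their supports being disjoint, the sum has seminorm [a]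
([glue_H1semi]) and its divergence has with [p0] an inner product of almost
[Bm a^2]. It does not see [p1], because the divergence of a field of H^1_0 of a
patch has mean 0 ([integral_divg]). Hence [S >= Bm a].

The function [p1] is handled by the continuous inf-sup condition: the projection
of a near-maximiser into the discrete space has the same inner products with the
patchwise constants and a seminorm at most [cF] times larger, and the boundedness
of the divergence form bounds the influence of [p0] by [delta a]
([divg_ip_le]). Hence [S >= (beta / cF) b - delta a]. The two bounds and
[|p| <= a + b] give the claim by arithmetic ([inf_sup_combine]).

The analytic content is in the facts that this uses silently. Norms over the
domain are sums over the patches because the boundary of a Lipschitz domain is a
null set ([lipschitz_boundary_negligible]). Extension by zero maps H^1_0 of a
patch to H^1_0 of the domain ([H10_ext0]) and gradients of H^1_0 functions have
mean 0 ([H10_integral_grad]); both follow from integration by parts for compactly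
supported functions ([integral_derive_eq0]). Since the suprema exclude the fields
that vanish almost everywhere, it also matters that such fields have a null
gradient ([H10_null_grad]). *)

(** * Inner product and norm on L^2 *)

(** The plane with its product Borel sigma-algebra: the bare product [R * R] only
carries a topology. *)
Notation mplane R := (measurableTypeR R * measurableTypeR R)%type.

Section L2.
Context {R : realType}.
Local Notation mu := (leb2 R).
Implicit Types (D E : set (plane R)) (f g h : plane R -> R).

Definition L1 f := mu.-integrable setT (EFin \o f).

Lemma restrictD_fun D f g : (f \+ g) \_ D = (f \_ D) \+ (g \_ D).
Proof. by apply/funext => x; rewrite /patch /=; case: ifP; rewrite ?addr0. Qed.

Lemma restrictZ_fun D a f : (fun x => a * f x) \_ D = fun x => a * (f \_ D) x.
Proof. by apply/funext => x; rewrite /patch /=; case: ifP; rewrite ?mulr0. Qed.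

Lemma restrictM_fun D f g : (fun x => f x * g x) \_ D = fun x => (f \_ D) x * (g \_ D) x.
Proof. by apply/funext => x; rewrite /patch /=; case: ifP; rewrite ?mulr0. Qed.

(** All the L^2 theory goes through this form: sums, restrictions and dominations
are easier for measurability and integrability than for the Lebesgue norm. *)
Lemma L2P D f : L2 D f <->
  measurable_fun setT (f \_ D : mplane R -> R) /\ L1 (fun x => (f \_ D) x ^+ 2).
Proof.
split.
  move=> H; split; last exact: Lfun2_integrable_sqr H.
  by move: H; rewrite /L2 inE => /andP[/[!inE]].
move=> [mf /integrableP[mf2 If]]; rewrite /L2 inE; apply/andP; split; rewrite inE//=.
rewrite /finite_norm unlock poweR_lty//=.
move: If; congr (_ < _)%E; apply: eq_integral => x _ /=.
by rewrite powR_mulrn// normrX.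
Qed.

Lemma L2D D f g : L2 D f -> L2 D g -> L2 D (f \+ g).
Proof.
rewrite /L2 restrictD_fun => Hf Hg.
have p1 : (1 <= 2%:E :> \bar R)%E by rewrite lee_fin; exact: (ler1n R 2).
by case: (@Lfun_addr_closed _ _ R mu 2%:E p1) => _ /(_ _ _ Hf Hg).
Qed.

Lemma L2Z D a f : L2 D f -> L2 D (fun x => a * f x).
Proof.
rewrite /L2 restrictZ_fun => Hf.
rewrite (_ : (fun x => _) = a \o* (f \_ D)).
  exact: (@Lfun_scale _ _ R mu (f \_ D) a 2 (ler1n _ 2) Hf).
by apply/funext => x /=; rewrite mulrC.
Qed.

Lemma L2_0 D : L2 D (cst 0).
Proof.
apply/L2P; rewrite (_ : _ \_ D = cst 0); last first.
  by apply/funext => x; rewrite /patch; case: ifP.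
split; first exact: measurable_cst.
by rewrite /L1; under eq_fun do rewrite /= expr0n/=; exact: integrable0.
Qed.

Lemma L2B D f g : L2 D f -> L2 D g -> L2 D (f \- g).
Proof.
move=> Hf Hg; have -> : f \- g = f \+ (fun x => -1 * g x) by apply/funext => x /=; rewrite mulN1r.
by apply: L2D => //; exact: L2Z.
Qed.

Lemma L2_sum D (I : finType) (P : pred I) (F : I -> plane R -> R) :
  (forall i, L2 D (F i)) -> L2 D (fun x => \sum_(i | P i) F i x).
Proof.
move=> HF; rewrite (_ : (fun x => _) = \sum_(i | P i) F i); last first.
  by apply/funext => x; rewrite fct_sumE.
elim/big_ind: _ => //; [exact: L2_0|exact: L2D].
Qed.

Lemma L1_mul D f g : L2 D f -> L2 D g -> L1 (fun x => (f \_ D) x * (g \_ D) x).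
Proof. by move=> Hf Hg; apply/Lfun1_integrable; exact: Lfun2_mul_Lfun1. Qed.

Lemma L2ipE D f g : L2ip D f g = \int[mu]_x ((f \_ D) x * (g \_ D) x).
Proof. by rewrite /L2ip Rintegral_mkcond restrictM_fun. Qed.

Lemma L2ipC D f g : L2ip D f g = L2ip D g f.
Proof. by apply: eq_Rintegral => x _; rewrite mulrC. Qed.

Lemma L2ipDl D f g h : L2 D f -> L2 D g -> L2 D h ->
  L2ip D (f \+ g) h = L2ip D f h + L2ip D g h.
Proof.
move=> Hf Hg Hh; rewrite !L2ipE -RintegralD//; do ?exact: L1_mul.
by apply: eq_Rintegral => x _; rewrite restrictD_fun/= mulrDl.
Qed.

Lemma L2ipZl D a f h : L2 D f -> L2 D h ->
  L2ip D (fun x => a * f x) h = a * L2ip D f h.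
Proof.
move=> Hf Hh; rewrite !L2ipE -RintegralZl//; do ?exact: L1_mul.
by apply: eq_Rintegral => x _; rewrite restrictZ_fun/= mulrA.
Qed.

Lemma L2ip0l D h : L2ip D (cst 0) h = 0.
Proof.
rewrite /L2ip Rintegral_mkcond -[RHS](Rintegral_set0 mu (cst 0)) [RHS]Rintegral_mkcond.
by apply: eq_Rintegral => x _; rewrite /patch /= mul0r !if_same.
Qed.

Lemma L2ipBl D f g h : L2 D f -> L2 D g -> L2 D h ->
  L2ip D (f \- g) h = L2ip D f h - L2ip D g h.
Proof.
move=> Hf Hg Hh; rewrite !L2ipE -RintegralB//; do ?exact: L1_mul.
apply: eq_Rintegral => x _; rewrite -mulrBl; congr (_ * _).
by rewrite /patch; case: ifP => //=; rewrite subr0.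
Qed.

Lemma L2ipDr D f g h : L2 D f -> L2 D g -> L2 D h ->
  L2ip D h (f \+ g) = L2ip D h f + L2ip D h g.
Proof. by move=> *; rewrite L2ipC L2ipDl// ![L2ip _ _ h]L2ipC. Qed.

Lemma L2ipZr D a f h : L2 D f -> L2 D h ->
  L2ip D h (fun x => a * f x) = a * L2ip D h f.
Proof. by move=> *; rewrite L2ipC L2ipZl// [L2ip _ _ h]L2ipC. Qed.

Lemma L2ipBr D f g h : L2 D f -> L2 D g -> L2 D h ->
  L2ip D h (f \- g) = L2ip D h f - L2ip D h g.
Proof. by move=> *; rewrite L2ipC L2ipBl// ![L2ip _ _ h]L2ipC. Qed.

Lemma L2ip_suml D (I : finType) (P : pred I) (F : I -> plane R -> R) h :
  (forall i, L2 D (F i)) -> L2 D h ->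
  L2ip D (fun x => \sum_(i | P i) F i x) h = \sum_(i | P i) L2ip D (F i) h.
Proof.
move=> HF Hh; rewrite (_ : (fun x => _) = \sum_(i | P i) F i); last first.
  by apply/funext => x; rewrite fct_sumE.
suff [] : L2ip D (\sum_(i | P i) F i) h = \sum_(i | P i) L2ip D (F i) h /\ L2 D (\sum_(i | P i) F i) by [].
elim/big_ind2: _ => //; first by split; [exact: L2ip0l|exact: L2_0].
move=> f1 a1 f2 a2 [<- H1] [<- H2]; split; [exact: L2ipDl|exact: L2D].
Qed.

Lemma L2ip_ge0 D f : 0 <= L2ip D f f.
Proof. by apply: Rintegral_ge0 => x _; rewrite -expr2 sqr_ge0. Qed.

Lemma L2norm_ge0 D f : 0 <= L2norm D f.
Proof. by rewrite fine_ge0// Lnorm_ge0. Qed.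

(** From here on the norm is handled as the norm of an inner product, so that
Cauchy-Schwarz and the triangle inequality become algebra. *)
Lemma sqr_L2norm D f : L2 D f -> L2norm D f ^+ 2 = L2ip D f f.
Proof.
move=> Hf; rewrite L2ipE /L2norm.
have lf : ('N[mu]_2%:E[EFin \o f \_ D] < +oo)%E.
  by move: Hf; rewrite /L2 inE => /andP[_ /[!inE]].
have ff : 'N[mu]_2%:E[EFin \o f \_ D]%E \is a fin_num.
  by rewrite ge0_fin_numE// Lnorm_ge0.
have n2 : 2 != 0 :> R by rewrite pnatr_eq0.
have := powR_Lnorm mu (EFin \o f \_ D) n2.
rewrite -[in LHS](fineK ff) poweR_EFin.
rewrite powR_mulrn ?fine_ge0 ?Lnorm_ge0// => H; apply: EFin_inj; rewrite H.
rewrite /Rintegral fineK; last first.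
  by apply: integrable_fin_num => //; exact: L1_mul.
by apply: eq_integral => x _ /=; rewrite powR_mulrn// real_normK ?num_real.
Qed.

Lemma L2normE D f : L2 D f -> L2norm D f = Num.sqrt (L2ip D f f).
Proof. by move=> Hf; rewrite -sqr_L2norm// sqrtr_sqr ger0_norm ?L2norm_ge0. Qed.

(** Cauchy-Schwarz, from the positivity of [(s f - t g, s f - t g)]: the choice
[s = |g|], [t = |f|] concludes when both norms are positive; if one of them
vanishes, a large factor in front of that function does. *)
Lemma L2ip_le D f g : L2 D f -> L2 D g -> L2ip D f g <= L2norm D f * L2norm D g.
Proof.
move=> Hf Hg.
set a := L2norm D f; set b := L2norm D g; set c := L2ip D f g.
have a0 : 0 <= a by exact: L2norm_ge0.
have b0 : 0 <= b by exact: L2norm_ge0.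
have H s t : 0 <= s ^+ 2 * a ^+ 2 - 2 * s * t * c + t ^+ 2 * b ^+ 2.
  have := L2ip_ge0 D ((fun x => s * f x) \- (fun x => t * g x)).
  have Hs := L2Z D s f Hf; have Ht := L2Z D t g Hg.
  rewrite L2ipBl//; last exact: L2B.
  rewrite !L2ipBr// !L2ipZl// !L2ipZr// [L2ip D g f]L2ipC -!sqr_L2norm// -/a -/b -/c.
  by congr (_ <= _); ring.
have [a0'|an0] := eqVneq a 0.
  rewrite a0' mul0r; have := H (b ^+ 2 + 1) 1; rewrite a0'.
  have := H (b ^+ 2 + 1) c; rewrite a0'; clear -b0; move: b c b0 => b c b0 + _.
  have [//|c0] := leP c 0.
  suff : 0 < c ^+ 2 * (b ^+ 2 + 2) by nra.
  by rewrite mulr_gt0 ?exprn_gt0//; nra.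
have [b0'|bn0] := eqVneq b 0.
  rewrite b0' mulr0; have := H c (a ^+ 2 + 1); rewrite b0'; clear -a0; move: a c a0 => a c a0 +.
  have [//|c0] := leP c 0.
  suff : 0 < c ^+ 2 * (a ^+ 2 + 2) by nra.
  by rewrite mulr_gt0 ?exprn_gt0//; nra.
have ab : 0 < a * b by rewrite mulr_gt0// lt0r ?an0 ?bn0.
have := H b a; rewrite (_ : _ + _ = 2 * (a * b) * (a * b - c)); last by ring.
by rewrite pmulr_rge0 ?subr_ge0// mulr_gt0.
Qed.

Lemma normr_L2ip_le D f g : L2 D f -> L2 D g -> `|L2ip D f g| <= L2norm D f * L2norm D g.
Proof.
move=> Hf Hg; rewrite ler_norml L2ip_le// andbT lerNl.
have <- : L2ip D (fun x => -1 * f x) g = - L2ip D f g by rewrite L2ipZl// mulN1r.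
have -> : L2norm D f = L2norm D (fun x => -1 * f x).
  have Hm := L2Z D (-1) f Hf.
  by rewrite !L2normE// L2ipZl// L2ipZr// !mulN1r opprK.
by apply: L2ip_le => //; exact: L2Z.
Qed.

Lemma ler_L2normD D f g : L2 D f -> L2 D g -> L2norm D (f \+ g) <= L2norm D f + L2norm D g.
Proof.
move=> Hf Hg; rewrite -(ler_pXn2r (n:=2))// ?nnegrE ?addr_ge0 ?L2norm_ge0//.
have Hd := L2D D f g Hf Hg.
rewrite sqr_L2norm// L2ipDl// !L2ipDr// [L2ip D g f]L2ipC -!sqr_L2norm//.
have := L2ip_le D f g Hf Hg; nra.
Qed.

Lemma L2normZ D a f : L2 D f -> L2norm D (fun x => a * f x) = `|a| * L2norm D f.
Proof.
move=> Hf; have Ha := L2Z D a f Hf.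
rewrite !L2normE// L2ipZl// L2ipZr// mulrA -expr2 sqrtrM ?sqr_ge0//.
by rewrite sqrtr_sqr.
Qed.

Lemma ae_eq_L2ip D f f' g : ae_eq mu D f f' -> L2 D f -> L2 D f' -> L2 D g ->
  L2ip D f g = L2ip D f' g.
Proof.
move=> aef Hf Hf' Hg; rewrite !L2ipE; congr fine.
apply: ae_eq_integral => //.
- by case/integrableP : (L1_mul D f g Hf Hg).
- by case/integrableP : (L1_mul D f' g Hf' Hg).
apply: filterS aef => x /= Dff' _; rewrite !patchE.
by case: ifPn => // /set_mem /Dff' ->.
Qed.

Lemma restrict_restrict D E f : E `<=` D -> (f \_ E) \_ D = f \_ E.
Proof.
move=> ED; apply/funext => x; rewrite !patchE; case: ifPn => // /negP xD.
by case: ifPn => // /set_mem/ED/mem_set.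
Qed.

Lemma restrict_sub D E f : E `<=` D -> (f \_ D) \_ E = f \_ E.
Proof.
move=> ED; apply/funext => x; rewrite !patchE; case: ifPn => // xE.
by rewrite ifT//; apply/mem_set/ED/set_mem.
Qed.

Lemma L2_ext D E f : E `<=` D -> L2 D (f \_ E) <-> L2 E f.
Proof. by move=> ED; rewrite /L2 restrict_restrict. Qed.

Lemma eq_L2norm D f g : (forall x, D x -> f x = g x) -> L2norm D f = L2norm D g.
Proof.
move=> fg; rewrite /L2norm (_ : f \_ D = g \_ D)//.
by apply/funext => x; rewrite !patchE; case: ifPn => // /set_mem /fg.
Qed.

Lemma eq_L2ip D f g f' g' : (forall x, D x -> f x = f' x) -> (forall x, D x -> g x = g' x) ->
  L2ip D f g = L2ip D f' g'.
Proof. by move=> ff gg; apply: eq_Rintegral => x /set_mem Dx; rewrite ff// gg. Qed.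

Lemma L2_sub D E f : E `<=` D -> measurable (E : set (mplane R)) -> L2 D f -> L2 E f.
Proof.
move=> ED mE /L2P[mf If]; apply/L2P; rewrite -(restrict_sub D E f ED).
have mfE : measurable_fun setT ((f \_ D) \_ E : mplane R -> R).
  by apply/(measurable_restrictT _ mE); exact (measurable_funTS mf).
split => //; apply: le_integrable If => //.
  by apply/measurable_EFinP; exact: measurable_funX.
move=> x _ /=; rewrite lee_fin [X in `|X ^+ 2|]patchE; case: ifPn => //.
by rewrite expr0n normr0.
Qed.

Lemma L2ip_ext D E f g : E `<=` D -> L2ip D (f \_ E) g = L2ip E f g.
Proof.
move=> ED; rewrite !L2ipE restrict_restrict//; apply: eq_Rintegral => x _.
rewrite -[in RHS](restrict_sub D E g ED) [in RHS]/patch /=.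
by rewrite ![(f \_ E) x]patchE; case: ifPn; rewrite ?mul0r.
Qed.

Lemma L2norm_ext D E f : E `<=` D -> L2norm D (f \_ E) = L2norm E f.
Proof. by move=> ED; rewrite /L2norm restrict_restrict. Qed.

Lemma L2_cst D c : measurable (D : set (mplane R)) -> (mu D < +oo)%E -> L2 D (cst c).
Proof.
move=> mD fD; apply/L2P; split.
  by apply/(measurable_restrictT _ mD); exact (measurable_cst c).
rewrite /L1 (_ : EFin \o _ = (cst (c ^+ 2)%:E) \_ D); last first.
  by apply/funext => x; rewrite /= !patchE; case: ifPn => // _; rewrite expr0n.
apply/(integrable_restrict _ mD measurableT); rewrite setTI; apply/integrableP; split.
  exact: measurable_cst.
by rewrite /= integral_cst// lte_mul_pinfty.
Qed.

(** On [D], [f] equals almost everywhere the sum of its restrictions to the pieces;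
bilinearity does the rest. *)
Lemma L2ip_partition (I : finType) D (E : I -> set (plane R)) f g :
  (forall i, E i `<=` D) -> (forall i, measurable (E i : set (mplane R))) ->
  (forall i j, i != j -> E i `&` E j = set0) ->
  mu.-negligible (D `\` \bigcup_i E i : set (mplane R)) ->
  L2 D f -> L2 D g -> L2ip D f g = \sum_i L2ip (E i) f g.
Proof.
move=> ED mE Edis Enull Hf Hg.
pose f' x := \sum_i (f \_ (E i)) x.
have HE i : L2 D (f \_ (E i)) by apply/L2_ext => //; exact: L2_sub Hf.
have f'E i x : E i x -> f' x = f x.
  move=> Ex; rewrite /f' (bigD1 i)//= patchE mem_set// big1 ?addr0// => j ji.
  rewrite patchE; case: ifPn => // /set_mem Ejx.
  by have /seteqP[+ _] := Edis j i ji => /(_ x) [].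
rewrite (@ae_eq_L2ip D f f') //; last exact: L2_sum.
  by rewrite L2ip_suml//; apply: eq_bigr => i _; rewrite L2ip_ext.
apply: negligibleS Enull => x /= /not_implyP[Dx ff']; split => // -[i _ Ex].
by apply: ff'; rewrite (f'E i).
Qed.

End L2.

(** * Borel sets and bounded sets of the plane *)

Section Plane.
Context {R : realType}.
Local Notation mu := (leb2 R).

(** The product topology in coordinates, which reduces every neighbourhood argument
below to real inequalities. *)
Lemma near_planeP (x : plane R) (P : plane R -> Prop) :
  (\forall y \near x, P y) <-> exists2 e : R, 0 < e &
    forall y, `|x.1 - y.1| < e -> `|x.2 - y.2| < e -> P y.
Proof.
split.
  move/nbhs_ballP => [e /= e0 He]; exists e => // y y1 y2; apply: He.
  by split; rewrite /ball/=.
move=> [e e0 He]; apply/nbhs_ballP; exists e => // y [y1 y2]; exact: He.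
Qed.

(** The closed ball of radius [e] in the sup norm. *)
Definition box (x : plane R) (e : R) : set (plane R) :=
  `[x.1 - e, x.1 + e] `*` `[x.2 - e, x.2 + e].

Lemma measurable_box (x : plane R) (e : R) : measurable (box x e : set (mplane R)).
Proof. by apply: measurableX; exact: measurable_itv. Qed.

Lemma box_measure (x : plane R) (e : R) : 0 <= e -> mu (box x e) = (4 * e ^+ 2)%:E.
Proof.
move=> e0; rewrite product_measure1E//.
have itvE (a : R) : lebesgue_measure (`[a - e, a + e] : set R) = (2 * e)%:E.
  rewrite lebesgue_measure_itv /= lte_fin; case: (ltP (a - e) (a + e)) => H.
    by rewrite -EFinB; congr EFin; ring.
  by congr EFin; lra.
transitivity ((2 * e)%:E * (2 * e)%:E)%E; first by congr (_ * _)%E; exact: itvE.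
by rewrite -EFinM; congr EFin; ring.
Qed.

(** An open set is the union of the countably many rational open rectangles that it
contains, and rectangles generate the product sigma-algebra. *)
Lemma open_measurable_plane (U : set (plane R)) : open U -> measurable (U : set (mplane R)).
Proof.
move=> oU.
pose F (q : (rat * rat) * (rat * rat)) : set (plane R) :=
  `]ratr q.1.1, ratr q.1.2[ `*` `]ratr q.2.1, ratr q.2.2[.
pose G q := if `[< F q `<=` U >] then F q else set0.
have -> : U = \bigcup_q (G q).
  apply/seteqP; split => [x Ux|x [q _]]; last first.
    by rewrite /G; case: asboolP => [FU|_ []] //; exact: FU.
  have /near_planeP[e e0 He] : \forall y \near x, U y by exact: open_nbhs_nbhs.
  have rat_near (a : R) : exists q : rat * rat, a - e < ratr q.1 < a /\ a < ratr q.2 < a + e.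
    have /rat_in_itvoo[q1 /itvP h1] : a - e < a by lra.
    have /rat_in_itvoo[q2 /itvP h2] : a < a + e by lra.
    by exists (q1, q2); rewrite !h1 !h2.
  have [q1 [/andP[a1 a2] /andP[a3 a4]]] := rat_near x.1.
  have [q2 [/andP[b1 b2] /andP[b3 b4]]] := rat_near x.2.
  exists (q1, q2) => //; rewrite /G asboolT.
    by split; rewrite /= in_itv/=; apply/andP.
  move=> y []; rewrite /= !in_itv/= => /andP[c1 c2] /andP[d1 d2].
  by apply: He; rewrite ltr_norml; apply/andP; split; lra.
apply: countable_bigcupT_measurable => // q; rewrite /G; case: ifP => _ //.
by apply: measurableX; exact: measurable_itv.
Qed.

Lemma continuous_measurable_plane (f : plane R -> R) :
  continuous f -> measurable_fun setT (f : mplane R -> R).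
Proof.
move=> /continuousP cf; apply: (measurability _ (RGenOpens.measurableE R)).
move=> _ [_ [a [b ->] <-]]; rewrite setTI; apply: open_measurable_plane.
exact/cf/interval_open.
Qed.

Lemma bounded_sub_box (D : set (plane R)) : bounded_set D ->
  exists2 M : R, 0 < M & D `<=` box 0 M.
Proof.
move=> [M [_ HM]]; exists (`|M| + 1); first by rewrite ltr_wpDl.
have HM1 : M < `|M| + 1 by rewrite (le_lt_trans (ler_norm M)) ?ltrDl.
move=> x Dx; have : Num.max `|x.1| `|x.2| <= `|M| + 1 := HM _ HM1 x Dx; rewrite ge_max => /andP[].
by rewrite !ler_norml => /andP[? ?] /andP[? ?]; split; rewrite /= in_itv/= ?sub0r ?add0r; apply/andP.
Qed.

Lemma box_compact (x : plane R) (e : R) : compact (box x e).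
Proof. by apply: compact_setX; exact: segment_compact. Qed.

Lemma box_closed (x : plane R) (e : R) : closed (box x e).
Proof.
apply: compact_closed (box_compact x e).
exact: norm_hausdorff.
Qed.

Lemma bounded_closure_compact (D : set (plane R)) : bounded_set D -> compact (closure D).
Proof.
move=> /bounded_sub_box[M M0 DM].
apply: (subclosed_compact _ (box_compact 0 M)); first exact: closed_closure.
by rewrite closureE; apply: smallest_sub => //; exact: box_closed.
Qed.

Lemma bounded_measure_fin (D : set (plane R)) : bounded_set D ->
  measurable (D : set (mplane R)) -> (mu D < +oo)%E.
Proof.
move=> /bounded_sub_box[M M0 DM] mD.
apply: (@le_lt_trans _ _ (mu (box 0 M))); last by rewrite box_measure ?ltW ?ltry.
by apply: le_measure => //; rewrite inE//; exact: measurable_box.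
Qed.

Lemma open_measure_gt0 (U : set (plane R)) : open U -> U !=set0 -> (0 < mu U)%E.
Proof.
move=> oU [x Ux].
have /near_planeP[e e0 He] : \forall y \near x, U y by exact: open_nbhs_nbhs.
have e20 : 0 <= e / 2 by lra.
apply: (@lt_le_trans _ _ (mu (box x (e / 2)))).
  by rewrite box_measure// lte_fin mulr_gt0// exprn_gt0// divr_gt0.
apply: le_measure; rewrite ?inE; [exact: measurable_box|exact: open_measurable_plane|].
move=> y []; rewrite /= !in_itv/= => /andP[? ?] /andP[? ?].
by apply: He; rewrite ltr_norml; apply/andP; split; lra.
Qed.

End Plane.

(** * The boundary of a Lipschitz domain is a null set *)

Section NullBoundary.
Context {R : realType}.
Local Notation mu := (leb2 R).

(** Intersect sets of measure at most [1 / (n + 1)]. *)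
Lemma negligible_small (S : set (plane R)) :
  (forall e : R, 0 < e -> exists A : set (mplane R),
     [/\ measurable A, S `<=` A & (mu A <= e%:E)%E]) -> mu.-negligible (S : set (mplane R)).
Proof.
move=> H.
have /choice[A HA] n : exists A : set (mplane R), [/\ measurable A, S `<=` A & (mu A <= (n.+1%:R^-1)%:E)%E].
  by apply: H; rewrite invr_gt0.
have mA n : measurable (A n) by case: (HA n).
have mI : measurable (\bigcap_n A n) by exact: bigcapT_measurable.
exists (\bigcap_n A n); split => //; last by move=> x Sx n _; case: (HA n) => _ + _; apply.
apply/eqP; rewrite eq_le measure_ge0 andbT; apply/lee_addgt0Pr => e e0; rewrite add0e.
have [n Hn] : exists n : nat, n.+1%:R^-1 < e.
  by exists (Num.bound e^-1); rewrite invf_plt ?posrE// (lt_trans (archi_boundP _)) ?invr_ge0 ?ltW// ltr_nat.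
case: (HA n) => _ _ /le_trans-/(_ e%:E); rewrite lee_fin ltW// => /(_ isT); apply: le_trans.
by apply: le_measure; rewrite ?inE//; exact: bigcap_inf.
Qed.

(** Cut the parameter interval into [M] equal pieces: each image lies in a square of
side [O(1 / M)], so the curve is covered by an area [O(1 / M)]. *)
Lemma lipschitz_curve_negligible (c : R -> plane R) (r C : R) : 0 < r -> 0 < C ->
  (forall s s', `|s| < r -> `|s'| < r ->
     `|(c s).1 - (c s').1| <= C * `|s - s'| /\ `|(c s).2 - (c s').2| <= C * `|s - s'|) ->
  mu.-negligible ([set c s | s in [set s | `|s| < r]] : set (mplane R)).
Proof.
move=> r0 C0 Hc; apply: negligible_small => e e0.
set B := 4 * (C * r) ^+ 2.
have B0 : 0 < B by rewrite mulr_gt0// exprn_gt0// mulr_gt0.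
pose M := (Num.bound (B / e)).+1.
have M0 : 0 < M%:R :> R by [].
have HM : B / M%:R <= e.
  rewrite ler_pdivrMr// mulrC -ler_pdivrMr// ltW// (lt_trans (archi_boundP _)) ?ltr_nat//.
  by rewrite divr_ge0 ?ltW.
(* [s i] is the midpoint of the [i]-th piece *)
pose s i : R := - r + (2 * i%:R + 1) * r / M%:R.
pose F (i : nat) : set (mplane R) := box (c (s i)) (C * r / M%:R).
have Cr0 : 0 <= C * r / M%:R by rewrite divr_ge0// ?mulr_ge0// ltW.
exists (\big[setU/set0]_(i < M) F i); split.
- by apply: bigsetU_measurable => i _; exact: measurable_box.
- move=> _ [t /= tr <-]; rewrite -bigcup_mkord.
  move: (tr); rewrite ltr_norml => /andP[t1 t2].
  pose i := Num.truncn ((t + r) * M%:R / (2 * r)).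
  have x0 : 0 <= (t + r) * M%:R / (2 * r) by rewrite divr_ge0 ?mulr_ge0//; lra.
  have /andP[i1 i2] := truncn_itv x0; rewrite -/i in i1 i2.
  move: i1 i2; rewrite ler_pdivlMr ?mulr_gt0// ltr_pdivrMr ?mulr_gt0// => i1 i2.
  have iM : (i < M)%N.
    rewrite -(ltr_nat R) -(ltr_pM2r (_ : 0 < 2 * r)) ?mulr_gt0//.
    apply: (le_lt_trans i1); rewrite mulrC ltr_pM2l//; lra.
  have sE j : s j * M%:R = - r * M%:R + (2 * j%:R + 1) * r.
    by rewrite /s mulrDl divfK// gt_eqF.
  have iM' : (i%:R + 1 <= M%:R :> R) by rewrite natr1 ler_nat.
  exists i => //.
  have si : `|s i| < r.
    rewrite ltr_norml -(ltr_pM2r M0) -[X in _ && X](ltr_pM2r M0) sE; apply/andP; split; last nra.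
    have : 0 <= i%:R :> R by []. 
    nra.
  have ts : `|t - s i| <= r / M%:R.
    have E : `|t - s i| * M%:R = `|t * M%:R - s i * M%:R|.
      by rewrite -mulrBl normrM (gtr0_norm M0).
    rewrite ler_pdivlMr// E sE ler_norml; rewrite -natr1 in i2.
    by apply/andP; split; lra.
  have [h1 h2] := Hc t (s i) tr si.
  have h : C * `|t - s i| <= C * r / M%:R by rewrite -mulrA ler_pM2l.
  move: (le_trans h1 h) (le_trans h2 h); rewrite !ler_norml => /andP[? ?] /andP[? ?].
  by split; rewrite /= in_itv/=; apply/andP; split; lra.
- apply: (@le_trans _ _ (\sum_(i < M) mu (F i))%E).
    apply: content_subadditive => //; first by move=> *; exact: measurable_box.
    by apply: bigsetU_measurable => i _; exact: measurable_box.
  rewrite (eq_bigr (fun=> (4 * (C * r / M%:R) ^+ 2)%:E)); last first.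
    by move=> i _; rewrite box_measure.
  rewrite sumEFin lee_fin sumr_const card_ord.
  apply: le_trans HM; rewrite -mulr_natr le_eqVlt; apply/orP; left; apply/eqP.
  have Mn0 : M%:R != 0 :> R by rewrite gt_eqF.
  by rewrite /B; clearbody M; field.
Qed.

(** An orthonormal pair of the plane has [n = (- d t_2, d t_1)] with [d = det (t, n)]
and [d^2 = 1], so the matrix with rows [t] and [n] is orthogonal. *)
Lemma orthonormal_frame (t n a : plane R) : edot t t = 1 -> edot n n = 1 -> edot t n = 0 ->
  edot a t *: t + edot a n *: n = a.
Proof.
case: t n a => [t1 t2] [n1 n2] [a1 a2]; rewrite /edot /= => tt nn tn.
pose d := t1 * n2 - t2 * n1.
have n2E : n2 = d * t1.
  have -> : d * t1 = n2 * (t1 * t1 + t2 * t2) - t2 * (t1 * n1 + t2 * n2) by rewrite /d; ring.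
  by rewrite tt tn; ring.
have n1E : n1 = - d * t2.
  have -> : - d * t2 = n1 * (t1 * t1 + t2 * t2) - t1 * (t1 * n1 + t2 * n2) by rewrite /d; ring.
  by rewrite tt tn; ring.
have dd : d ^+ 2 = 1.
  have -> : d ^+ 2 = (t1 * t1 + t2 * t2) * (n1 * n1 + n2 * n2) - (t1 * n1 + t2 * n2) ^+ 2 by rewrite /d; ring.
  by rewrite tt nn tn; ring.
have q1 : t1 ^+ 2 + n1 ^+ 2 = 1.
  have -> : t1 ^+ 2 + n1 ^+ 2 = (t1 * t1 + t2 * t2) + (d ^+ 2 - 1) * t2 ^+ 2 by rewrite n1E; ring.
  by rewrite tt dd; ring.
have q2 : t2 ^+ 2 + n2 ^+ 2 = 1.
  have -> : t2 ^+ 2 + n2 ^+ 2 = (t1 * t1 + t2 * t2) + (d ^+ 2 - 1) * t1 ^+ 2 by rewrite n2E; ring.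
  by rewrite tt dd; ring.
have q3 : t1 * t2 + n1 * n2 = 0.
  have -> : t1 * t2 + n1 * n2 = t1 * t2 * (1 - d ^+ 2) by rewrite n1E n2E; ring.
  by rewrite dd; ring.
congr pair; rewrite /GRing.scale/=.
  have -> : (a1 * t1 + a2 * t2) * t1 + (a1 * n1 + a2 * n2) * n1 =
    a1 * (t1 ^+ 2 + n1 ^+ 2) + a2 * (t1 * t2 + n1 * n2) by ring.
  by rewrite q1 q3; ring.
have -> : (a1 * t1 + a2 * t2) * t2 + (a1 * n1 + a2 * n2) * n2 =
  a2 * (t2 ^+ 2 + n2 ^+ 2) + a1 * (t1 * t2 + n1 * n2) by ring.
by rewrite q2 q3; ring.
Qed.

(** Inside a chart, the points strictly below the graph are interior and the points
strictly above it are exterior, both by continuity of the graph function: the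
boundary lies on the graph, a Lipschitz curve. *)
Lemma lipschitz_boundary_loc (D : set (plane R)) x0 : lipschitz_boundary D -> boundary D x0 ->
  exists V : set (plane R),
    [/\ open V, V x0 & mu.-negligible (V `&` boundary D : set (mplane R))].
Proof.
move=> lD /lD[t [n [r [h [L [gam [[tt nn tn] [r0 h0 gamh gamL gamD]]]]]]]].
pose T := `|t.1| + `|t.2| + `|n.1| + `|n.2| + 1.
have [p1 p2 p3 p4] : [/\ 0 <= `|t.1|, 0 <= `|t.2|, 0 <= `|n.1| & 0 <= `|n.2|] by split.
have T1 : 1 <= T by rewrite /T; lra.
have T0 : 0 < T by lra.
pose s (y : plane R) := edot (y - x0) t.
pose tau (y : plane R) := edot (y - x0) n.
have yE y : y = x0 + s y *: t + tau y *: n.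
  by rewrite -addrA orthonormal_frame// addrC subrK.
have bnd (v : plane R) (x y : plane R) e : `|v.1| + `|v.2| <= T -> 
    `|x.1 - y.1| < e -> `|x.2 - y.2| < e -> `|edot (x - x0) v - edot (y - x0) v| <= e * T.
  move=> vT h1 h2; have e0 : 0 <= e by exact: le_trans (ltW h1).
  have -> : edot (x - x0) v - edot (y - x0) v = (x.1 - y.1) * v.1 + (x.2 - y.2) * v.2.
    by rewrite /edot /=; ring.
  apply: (le_trans (ler_normD _ _)); rewrite !normrM.
  apply: (@le_trans _ _ (e * `|v.1| + e * `|v.2|)); last by rewrite -mulrDr ler_wpM2l.
  by rewrite lerD// ler_wpM2r// ltW.
have tT : `|t.1| + `|t.2| <= T by rewrite /T; lra.
have nT : `|n.1| + `|n.2| <= T by rewrite /T; lra.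
have s0 : s x0 = 0 by rewrite /s subrr /edot/= !mul0r addr0.
have tau0 : tau x0 = 0 by rewrite /tau subrr /edot/= !mul0r addr0.
(* small enough for the chart coordinates to stay below [r] and [h] *)
pose eps := Num.min r h / (2 * T).
have m0 : 0 < Num.min r h by rewrite lt_min r0.
have eps0 : 0 < eps by rewrite divr_gt0// mulr_gt0.
have epsT : eps * T < r /\ eps * T < h.
  have -> : eps * T = Num.min r h / 2 by rewrite /eps; field; rewrite gt_eqF.
  have /andP[] : (Num.min r h <= r) && (Num.min r h <= h) by rewrite ge_min lexx ge_min lexx orbT.
  by split; lra.
exists (ball x0 eps); split; [exact: ball_open|exact: ballxx|].
pose c u : plane R := x0 + u *: t + gam u *: n.
apply: (@negligibleS _ _ _ _ ([set c u | u in [set u | `|u| < r]] : set (mplane R))); last first.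
  apply: (@lipschitz_curve_negligible _ _ ((1 + `|L|) * T)) => //.
    by rewrite mulr_gt0// ltr_pwDl.
  move=> u u' ur ur'.
  have gL : `|gam u - gam u'| <= `|L| * `|u - u'|.
    by apply: (le_trans (gamL _ _ ur ur')); rewrite ler_wpM2r// ler_norm.
  have aux (v w : R) : `|v| + `|w| <= T ->
      `|u * v + gam u * w - (u' * v + gam u' * w)| <= (1 + `|L|) * T * `|u - u'|.
    move=> vw; have -> : u * v + gam u * w - (u' * v + gam u' * w) = (u - u') * v + (gam u - gam u') * w by ring.
    apply: (le_trans (ler_normD _ _)); rewrite !normrM.
    have := normr_ge0 v; have := normr_ge0 w; have := normr_ge0 L; have := normr_ge0 (u - u').
    move: `|v| `|w| `|L| `|u - u'| `|gam u - gam u'| vw gL => V W l d g vw gL d0 l0 W0 V0.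
    have k1 : 0 <= (1 + l) * d * (T - (V + W)) by rewrite !mulr_ge0 ?subr_ge0 ?addr_ge0.
    have k2 : 0 <= W * (l * d - g) by rewrite mulr_ge0 ?subr_ge0.
    have k3 : 0 <= d * W by rewrite mulr_ge0.
    have k4 : 0 <= l * d * V by rewrite !mulr_ge0.
    lra.
  have [v1 v2] : `|t.1| + `|n.1| <= T /\ `|t.2| + `|n.2| <= T by rewrite /T; split; lra.
  split; rewrite /c /= /GRing.scale/=.
    by have := aux t.1 n.1 v1; congr (`|_| <= _); ring.
  by have := aux t.2 n.2 v2; congr (`|_| <= _); ring.
move=> x [[b1 b2] [clx nintx]]; rewrite /ball/= in b1 b2.
have [sr sh] : `|s x| < r /\ `|tau x| < h.
  have := bnd t x0 x eps tT b1 b2; have := bnd n x0 x eps nT b1 b2.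
  rewrite -/(s x) -/(s x0) -/(tau x) -/(tau x0) s0 tau0 !sub0r !normrN.
  by case: epsT => ? ? h1 h2; split; [exact: le_lt_trans h2 _|exact: le_lt_trans h1 _].
exists (s x) => //=; rewrite /c [RHS]yE; congr (_ + _ *: _).
(* strictly on one side of the graph, a whole neighbourhood is on that side *)
have near_side (gap : R) : 0 < gap -> \forall y \near x,
    [/\ `|s y| < r, `|tau y| < h & `|(gam (s y) - tau y) - (gam (s x) - tau x)| < gap].
  move=> gap0.
  pose m := Num.min (Num.min (r - `|s x|) (h - `|tau x|)) gap.
  have m1 : 0 < m by rewrite !lt_min !subr_gt0 sr sh gap0.
  have [m2 m3 m4] : [/\ m <= r - `|s x|, m <= h - `|tau x| & m <= gap].
    by rewrite /m; split; rewrite !ge_min lexx ?orbT.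
  pose e := m / ((2 + `|L|) * T * 2).
  have L0 := normr_ge0 L.
  have den0 : 0 < (2 + `|L|) * T * 2 by rewrite !mulr_gt0// ltr_pwDl.
  have eT : e * T * (2 + `|L|) = m / 2.
    by rewrite /e; field; apply/andP; split; rewrite gt_eqF//; lra.
  have e0 : 0 < e by rewrite divr_gt0.
  apply/near_planeP; exists e => // y y1 y2.
  have := bnd t x y e tT y1 y2; have := bnd n x y e nT y1 y2.
  rewrite -/(s x) -/(s y) -/(tau x) -/(tau y) => d1 d2.
  have eT0 : 0 < e * T by rewrite mulr_gt0.
  have eTm : e * T <= m / 4 by nra.
  have sy : `|s y| < r.
    by have := lerB_dist (s y) (s x); rewrite distrC; lra.
  split => //.
    by have := lerB_dist (tau y) (tau x); rewrite distrC; lra.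
  have gL : `|gam (s y) - gam (s x)| <= `|L| * (e * T).
    apply: (le_trans (gamL _ _ sy sr)); apply: (@le_trans _ _ (`|L| * `|s y - s x|)).
      by rewrite ler_wpM2r// ler_norm.
    by rewrite ler_wpM2l// distrC.
  have -> : gam (s y) - tau y - (gam (s x) - tau x) = (gam (s y) - gam (s x)) + (tau x - tau y) by ring.
  apply: (le_lt_trans (ler_normD _ _)); nra.
apply/eqP; rewrite eq_le; apply/andP; split.
- rewrite leNgt; apply/negP => lt; apply: nintx.
  have gap0 : 0 < gam (s x) - tau x by rewrite subr_gt0.
  apply: filterS (near_side _ gap0) => y [ys yt].
  rewrite ltr_norml => /andP[g1 _]; rewrite [y]yE; apply/gamD => //; lra.
- rewrite leNgt; apply/negP => lt.
  have gap0 : 0 < tau x - gam (s x) by rewrite subr_gt0.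
  have [y [Dy [ys yt]]] := clx _ (near_side _ gap0).
  rewrite ltr_norml => /andP[_ g1]; move: Dy; rewrite [y]yE => /gamD-/(_ ys yt); lra.
Qed.

(** The boundary is compact and locally negligible. Compactness is used in its
near-covering form, for the filter generated by the supersets of negligible sets. *)
Lemma lipschitz_boundary_negligible (D : set (plane R)) : bounded_set D ->
  lipschitz_boundary D -> mu.-negligible (boundary D : set (mplane R)).
Proof.
move=> bD lD.
have cB : compact (boundary D).
  apply: (subclosed_compact _ (bounded_closure_compact D bD)); last by move=> x [].
  apply: closedI; first exact: closed_closure.
  by apply: open_closedC; exact: open_interior.
pose F : set_system (set (plane R)) := [set S | exists2 N : set (mplane R),
  mu.-negligible N & forall M : set (plane R), mu.-negligible (M : set (mplane R)) -> N `<=` M -> S M].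
have FF : Filter F.
  split.
  - by exists set0 => //; exact: negligible_set0.
  - move=> S S' [N nN HN] [N' nN' HN']; exists (N `|` N'); first exact: negligibleU.
    by move=> M nM NM; split; [apply: HN|apply: HN'] => // x Nx; apply: NM; [left|right].
  - by move=> S S' SS' [N nN HN]; exists N => // M nM NM; apply/SS'/HN.
have [] := (compact_near_coveringP (boundary D)).1 cB _ F (fun M x => boundary D x -> M x) FF.
  move=> x /(lipschitz_boundary_loc D x lD)[V [oV Vx nV]].
  exists (V, [set M | V `&` boundary D `<=` M]) => /=.
    by split; [exact: open_nbhs_nbhs|exists (V `&` boundary D)].
  by move=> [y M] [/= Vy VM] By; exact: VM.
by move=> N nN /(_ N nN) H; apply: negligibleS nN => x Bx; exact: H.
Qed.

End NullBoundary.

(** * Test functions and H^1_0 *)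

Local Notation sval := Defs.sval.

Section TestFunctions.
Context {R : realType}.
Local Notation mu := (leb2 R).
Implicit Types (D E : set (plane R)) (f g h phi psi chi : plane R -> R).

Lemma compact_closed_plane (A : set (plane R)) : compact A -> closed A.
Proof. by apply: compact_closed; exact: norm_hausdorff. Qed.

Lemma derive_supp (A : set (plane R)) (j : 'I_2) f : compact A -> (forall x, ~ A x -> f x = 0) ->
  forall x, ~ A x -> 'D_(evec j) f x = 0.
Proof.
move=> cA f0 x nAx; rewrite -(derive_cst (0 : R) x (evec j)).
apply: near_eq_derive.
have : \forall y \near x, ~ A y.
  by apply: open_nbhs_nbhs; split => //; apply: closed_openC; exact: compact_closed_plane.
by apply: filterS => y /f0 ->.
Qed.

Lemma L2_supp (A : set (plane R)) g : continuous g -> compact A -> (forall x, ~ A x -> g x = 0) ->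
  L2 setT g.
Proof.
move=> cg cA g0.
have [M M0 AM] := bounded_sub_box _ (compact_bounded cA).
have cgA : compact (g @` A) by apply: continuous_compact => //; exact: continuous_subspaceT.
have [N [_ HN]] := compact_bounded cgA.
have gN x : `|g x| <= `|N| + 1.
  have [Ax|/g0 ->] := pselect (A x); last by rewrite normr0 addr_ge0.
  apply: (HN (`|N| + 1)); last by exists x.
  by rewrite (le_lt_trans (ler_norm N)) ?ltrDl.
have mb := measurable_box (0 : plane R) M.
have := L2_cst (box 0 M) (`|N| + 1) mb.
rewrite box_measure ?ltW// ltry => /(_ isT) /L2P[_ I1].
have mg := continuous_measurable_plane _ cg.
apply/L2P; rewrite (_ : g \_ setT = g); last by apply/funext => x; rewrite patchE in_setT.
split => //; apply: le_integrable I1 => //.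
  by apply/measurable_EFinP; exact: (measurable_funX 2 mg).
move=> x _ /=; rewrite lee_fin !normrX; apply: lerXn2r; rewrite ?nnegrE//.
rewrite patchE; case: ifPn => [_|/negP xM]; first by rewrite (ger0_norm (addr_ge0 _ _)).
by rewrite g0 ?normr0// => /AM /mem_set.
Qed.

Lemma L1_supp (A : set (plane R)) g : continuous g -> compact A -> (forall x, ~ A x -> g x = 0) ->
  L1 g.
Proof.
move=> cg cA g0; have Lg := L2_supp A g cg cA g0.
have [M M0 AM] := bounded_sub_box _ (compact_bounded cA).
have mb := measurable_box (0 : plane R) M.
have Lb : L2 setT ((cst 1 : plane R -> R) \_ (box 0 M)).
  by apply/L2_ext => //; apply: L2_cst => //; rewrite box_measure ?ltW// ltry.
have := L1_mul _ _ _ Lg Lb; congr L1; apply/funext => x.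
rewrite !patchE in_setT; case: ifPn => [_|/negP xM]; rewrite ?mulr1// mulr0.
by rewrite g0// => /AM /mem_set.
Qed.

(** The fundamental theorem of calculus on an interval that contains the support. *)
Lemma line_integral_derive (F F' : R -> R) (b : R) : 0 < b ->
  continuous F' -> (forall t, derivable F t 1) -> (forall t, derive1 F t = F' t) ->
  F (- b) = 0 -> F b = 0 -> (forall t, b < `|t| -> F' t = 0) ->
  (\int[@lebesgue_measure R]_t (F' t)%:E = 0)%E.
Proof.
move=> b0 cF' dF F'E Fa Fb F'0.
have ab : - b < b by rewrite gtrN.
have cF : continuous F.
  by move=> t; apply: differentiable_continuous; apply/derivable1_diffP; exact: dF.
have := @continuous_FTC2 R F' F (- b) b ab.
rewrite Fa Fb subee// => H.
rewrite -[RHS]H; last 3 first.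
- exact: continuous_subspaceT.
- split => //; [apply: cvg_at_right_filter|apply: cvg_at_left_filter]; exact: cF.
- by move=> t _; exact: F'E.
rewrite [RHS]integral_mkcond; apply: eq_integral => t _.
rewrite patchE; case: ifPn => //; rewrite notin_setE /= in_itv/= -ler_norml => /negP.
by rewrite -ltNge => /F'0 ->.
Qed.

(** A partial derivative in the plane is an ordinary derivative along a line, since
the two difference quotients are equal. *)
Lemma derive_slice chi (j : 'I_2) (x : plane R) :
  (forall y, derivable chi y (evec j)) ->
  let F (t : R) := chi (if j == ord0 then (t, x.2) else (x.1, t)) in
  forall t, derivable F t 1 /\
    derive1 F t = 'D_(evec j) chi (if j == ord0 then (t, x.2) else (x.1, t)).
Proof.
move=> dchi F t; set y := (if _ then _ else _).
have E : (fun h : R => h^-1 *: ((F \o shift t) (h *: 1) - F t)) =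
         (fun h : R => h^-1 *: ((chi \o shift y) (h *: evec j) - chi y)).
  apply/funext => h; congr (_ *: (_ - _)); rewrite /F /= /shift /y.
  rewrite /evec; case: j {dchi F y} => -[|[|//]] ij; congr chi;
  by rewrite [RHS]surjective_pairing; congr pair; rewrite /= /GRing.scale/= ?mulr1 ?mulr0 ?add0r.
split; first by rewrite /derivable E; exact: dchi.
by rewrite derive1E /derive E.
Qed.

(** The divergence theorem for compactly supported functions: by Fubini, integrate
first along the lines parallel to the direction of differentiation. *)
Lemma integral_derive_eq0 (A : set (plane R)) chi (j : 'I_2) : compact A ->
  (forall x, ~ A x -> chi x = 0) ->
  (forall x, derivable chi x (evec j)) -> continuous ('D_(evec j) chi) ->
  L1 ('D_(evec j) chi) /\ \int[mu]_x 'D_(evec j) chi x = 0.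
Proof.
move=> cA chi0 dchi cD.
have D0 := derive_supp A j chi cA chi0.
have Ld : L1 ('D_(evec j) chi) by exact: L1_supp D0.
split => //; rewrite /Rintegral.
have [M M0 AM] := bounded_sub_box _ (compact_bounded cA).
have outA (x : plane R) : M < `|x.1| \/ M < `|x.2| -> ~ A x.
  move=> H /AM[]; rewrite /= !in_itv/= !sub0r !add0r -!ler_norml => h1 h2.
  by case: H; rewrite ltNge ?h1 ?h2.
have slice (x : plane R) : (\int[@lebesgue_measure R]_t ('D_(evec j) chi (if j == ord0 then (t, x.2) else (x.1, t)))%:E = 0)%E.
  pose F (t : R) := chi (if j == ord0 then (t, x.2) else (x.1, t)).
  have dF : forall t, derivable F t 1 /\ derive1 F t = _ := derive_slice chi j x dchi.
  have outF t : M < `|t| -> ~ A (if j == ord0 then (t, x.2) else (x.1, t)).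
    by move=> Mt; apply: outA; case: ifP => _; [left|right].
  have M1 : M < M + 1 by rewrite ltrDl.
  apply: (@line_integral_derive F _ (M + 1)).
  - lra.
  - move=> t; apply: (@continuous_comp _ _ _ (fun t : R => if j == ord0 then (t, x.2) else (x.1, t)) ('D_(evec j) chi)); last exact: cD.
    case: (j == ord0); [apply: (@cvg_pair _ _ _ _ (nbhs t) (nbhs x.2))|apply: (@cvg_pair _ _ _ _ (nbhs x.1) (nbhs t))];
      by [exact: cvg_id|exact: cvg_cst].
  - by move=> t; have [] := dF t.
  - by move=> t; case: (dF t).
  - by rewrite /F chi0//; apply: outF; rewrite normrN ger0_norm//; lra.
  - by rewrite /F chi0//; apply: outF; rewrite ger0_norm//; lra.
  - by move=> t Mt; apply: D0; apply: outF; lra.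
case: j slice {dchi cD D0} Ld => -[|[|//]] ij slice Ld.
  rewrite -(integral21_prod_meas1 Ld) (_ : fubini_G _ _ = cst 0%E) ?integral0//.
  by apply/funext => y; rewrite /fubini_G; exact: (slice (0, y)).
rewrite -(integral12_prod_meas1 Ld) (_ : fubini_F _ _ = cst 0%E) ?integral0//.
by apply/funext => y; rewrite /fubini_F; exact: (slice (y, 0)).
Qed.

Lemma Ck_scale n a f : Ck n f -> Ck n (fun x => a * f x).
Proof.
elim: n f => [|n IHn] f /=.
  by move=> cf x; apply: cvgM; [exact: cvg_cst|exact: cf].
move=> [cf df Df]; split.
- by move=> x; apply: cvgM; [exact: cvg_cst|exact: cf].
- by move=> j x; apply: (derivableZ (df j x)).
- move=> j; rewrite (_ : 'D_(evec j) _ = fun x => a * 'D_(evec j) f x); first exact: IHn.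
  by apply/funext => x; exact: (deriveZ a (df j x)).
Qed.

Lemma Ck_add n f g : Ck n f -> Ck n g -> Ck n (f \+ g).
Proof.
elim: n f g => [|n IHn] f g /=.
  by move=> cf cg x; apply: cvgD; [exact: cf|exact: cg].
move=> [cf df Df] [cg dg Dg]; split.
- by move=> x; apply: cvgD; [exact: cf|exact: cg].
- by move=> j x; apply: (derivableD (df j x) (dg j x)).
- move=> j; rewrite (_ : 'D_(evec j) _ = 'D_(evec j) f \+ 'D_(evec j) g); first exact: IHn.
  by apply/funext => x; exact: (deriveD (df j x) (dg j x)).
Qed.

Lemma Ck_0 n : Ck n (cst 0 : plane R -> R).
Proof.
elim: n => [|n IHn] /=; first by move=> x; exact: cvg_cst.
split; [by move=> x; exact: cvg_cst|by move=> j x; exact: derivable_cst|].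
by move=> j; rewrite (_ : 'D_(evec j) _ = cst 0)//; apply/funext => x; rewrite derive_cst.
Qed.

Lemma test_fun_continuous D phi : test_fun D phi -> continuous phi.
Proof. by case=> /(_ 0%N). Qed.

Lemma test_fun_derivable D phi j x : test_fun D phi -> derivable phi x (evec j).
Proof. by case=> /(_ 1%N)[_ + _] _; exact. Qed.

Lemma test_fun_out D phi x : test_fun D phi -> ~ D x -> phi x = 0.
Proof. by move=> [_ [A [_ AD A0]]] nD; apply: A0 => /AD. Qed.

Lemma test_fun_derive D phi j : test_fun D phi -> test_fun D ('D_(evec j) phi).
Proof.
move=> [sm [A [cA AD A0]]]; split; first by move=> n; have [_ _ +] := sm n.+1; exact.
by exists A; split => //; exact: derive_supp.
Qed.

Lemma test_fun_sub D E phi : D `<=` E -> test_fun D phi -> test_fun E phi.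
Proof. by move=> DE [sm [A [cA AD A0]]]; split => //; exists A; split => // x /AD/DE. Qed.

Lemma test_fun_scale D a phi : test_fun D phi -> test_fun D (fun x => a * phi x).
Proof.
move=> [sm [A [cA AD A0]]]; split; first by move=> n; exact: Ck_scale.
by exists A; split => // x nA; rewrite A0// mulr0.
Qed.

Lemma test_fun_add D phi psi : test_fun D phi -> test_fun D psi -> test_fun D (phi \+ psi).
Proof.
move=> [sm [A [cA AD A0]]] [sm' [A' [cA' AD' A0']]]; split; first by move=> n; exact: Ck_add.
exists (A `|` A'); split; [exact: compactU|by rewrite subUset|].
by move=> x /not_orP[nA nA']; rewrite /= A0// A0'// addr0.
Qed.

Lemma test_fun_0 D : test_fun D (cst 0).
Proof. by split; [exact: Ck_0|exists set0; split => //; exact: compact0]. Qed.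

Lemma test_fun_L2T D phi : test_fun D phi -> L2 setT phi.
Proof.
by move=> tphi; have [_ [A [cA _ A0]]] := tphi; apply: (L2_supp A) => //; exact: test_fun_continuous tphi.
Qed.

Lemma test_fun_L2 D E phi : measurable (E : set (mplane R)) -> test_fun D phi -> L2 E phi.
Proof. by move=> mE /test_fun_L2T; apply: L2_sub. Qed.

Lemma L2ip_out D E f g : D `<=` E -> (forall x, ~ D x -> f x = 0) -> L2ip E f g = L2ip D f g.
Proof.
move=> DE f0; rewrite -(L2ip_ext E D)//; apply: eq_L2ip => // x _.
by rewrite patchE; case: ifPn => // /negP nD; apply: f0 => Dx; apply: nD; exact: mem_set.
Qed.

(** [phi psi] is a compactly supported C^1 function, so its derivative has integral 0. *)
Lemma test_fun_by_parts D E phi psi j : test_fun D phi -> test_fun E psi ->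
  L2ip setT ('D_(evec j) phi) psi = - L2ip setT phi ('D_(evec j) psi).
Proof.
move=> tphi tpsi; apply/eqP; rewrite -subr_eq0 opprK; apply/eqP.
have tD := test_fun_derive _ _ j tphi; have tE := test_fun_derive _ _ j tpsi.
have dphi x := test_fun_derivable _ _ j x tphi.
have dpsi x := test_fun_derivable _ _ j x tpsi.
have cphi := test_fun_continuous _ _ tphi; have cpsi := test_fun_continuous _ _ tpsi.
have cD := test_fun_continuous _ _ tD; have cE := test_fun_continuous _ _ tE.
have DM : 'D_(evec j) (phi * psi) = (fun x => 'D_(evec j) phi x * psi x + phi x * 'D_(evec j) psi x).
  apply/funext => x; rewrite deriveM//.
  by rewrite addrC /GRing.scale/= [psi x * _]mulrC.
have [_ [A [cA _ A0]]] := tphi.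
have aux : (\int[mu]_x 'D_(evec j) (phi * psi) x =
     L2ip setT ('D_(evec j) phi) psi + L2ip setT phi ('D_(evec j) psi)).
  rewrite DM /L2ip RintegralD//.
  - have := L1_mul _ _ _ (test_fun_L2T _ _ tD) (test_fun_L2T _ _ tpsi).
    by rewrite !(_ : forall f, f \_ setT = f)// => f; apply/funext => x; rewrite patchE in_setT.
  - have := L1_mul _ _ _ (test_fun_L2T _ _ tphi) (test_fun_L2T _ _ tE).
    by rewrite !(_ : forall f, f \_ setT = f)// => f; apply/funext => x; rewrite patchE in_setT.
rewrite -aux; have [||_ -> //] := integral_derive_eq0 A (phi * psi) j cA _ (fun x => derivableM (dphi x) (dpsi x)).
- by move=> x nA; rewrite /GRing.mul/= A0// mul0r.
- by rewrite DM => x; apply: cvgD; apply: cvgM; [exact: cD|exact: cpsi|exact: cphi|exact: cE].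
Qed.

(** By Cauchy-Schwarz the inner product is continuous, which transfers to H^1_0 every
identity that test functions satisfy. *)
Lemma L2ip_cvg D (F : nat -> plane R -> R) f g : (forall n, L2 D (F n)) -> L2 D f -> L2 D g ->
  L2norm D (F n \- f) @[n --> \oo] --> (0 : R) ->
  L2ip D (F n) g @[n --> \oo] --> L2ip D f g.
Proof.
move=> HF Hf Hg Ff.
suff H : L2ip D (F n) g - L2ip D f g @[n --> \oo] --> (0 : R).
  rewrite (_ : (fun n => _) = (fun n => (L2ip D (F n) g - L2ip D f g) + L2ip D f g)); last first.
    by apply/funext => n; rewrite subrK.
  rewrite -[X in _ --> X]add0r; apply: cvgD H _; exact: cvg_cst.
apply/norm_cvg0P.
apply: (@squeeze_cvgr _ _ _ _ (cst 0) (fun n => L2norm D (F n \- f) * L2norm D g)).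
- near=> n; rewrite normr_ge0/= -L2ipBl//; apply: normr_L2ip_le => //; exact: L2B.
- exact: cvg_cst.
- by rewrite -(mul0r (L2norm D g)); apply: cvgM => //; exact: cvg_cst.
Unshelve. all: by end_near. Qed.

Lemma H1_L2 D (u : sobfun) : H1 D u -> L2 D (sval u) /\ forall j, L2 D (sgrad u j).
Proof. by case=> Hu Hj; split => // j; case: (Hj j). Qed.

Lemma H10_L2 D (u : sobfun) : H10 D u -> L2 D (sval u) /\ forall j, L2 D (sgrad u j).
Proof. by case=> /H1_L2. Qed.

(** Extension by zero. *)
Definition ext0 D (u : sobfun) : sobfun := Sobfun (sval u \_ D) (fun j => sgrad u j \_ D).

Lemma L2normB_ext D E f phi : D `<=` E -> (forall x, ~ D x -> phi x = 0) ->
  L2norm E (phi \- f \_ D) = L2norm D (phi \- f).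
Proof.
move=> DE p0; rewrite -(L2norm_ext E D)//; apply: eq_L2norm => x _ /=.
rewrite !patchE; case: ifPn => // /negP nD; rewrite p0 ?subr0//.
by move=> Dx; apply: nD; exact: mem_set.
Qed.

(** The approximating test functions of [D] are test functions of [E]. That the
extended gradient is a weak gradient on [E] has to be checked against test
functions of [E], which need not vanish near the boundary of [D]: integrate by
parts with the approximants of [u], which do, and pass to the limit. *)
Lemma H10_ext0 D E (u : sobfun) : D `<=` E -> measurable (D : set (mplane R)) ->
  H10 D u -> H10 E (ext0 D u).
Proof.
move=> DE mD Hu; have [Lu Lg] := H10_L2 _ _ Hu.
case: Hu => _ [phi [tphi cphi cdphi]].
split; last first.
  exists phi; split.
  - by move=> n; exact: test_fun_sub (tphi n).
  - rewrite (_ : (fun n => _) = (fun n => L2norm D (phi n \- sval u)))//.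
    by apply/funext => n; rewrite L2normB_ext// => x; exact: test_fun_out (tphi n).
  - move=> j; rewrite (_ : (fun n => _) = (fun n => L2norm D ('D_(evec j) (phi n) \- sgrad u j)))//.
    apply/funext => n; rewrite L2normB_ext// => x.
    exact: test_fun_out (test_fun_derive _ _ j (tphi n)).
split; first exact/L2_ext.
move=> j; split; first exact/L2_ext.
move=> psi tpsi; rewrite /= !L2ip_ext//.
have Lpsi : L2 D psi by exact: test_fun_L2 tpsi.
have Ldpsi : L2 D ('D_(evec j) psi) by exact: test_fun_L2 (test_fun_derive _ _ j tpsi).
have Lp n : L2 D (phi n) by exact: test_fun_L2 (tphi n).
have Ldp n : L2 D ('D_(evec j) (phi n)) by exact: test_fun_L2 (test_fun_derive _ _ j (tphi n)).
have c1 := L2ip_cvg D phi _ _ Lp Lu Ldpsi cphi.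
have c2 := L2ip_cvg D _ _ _ Ldp (Lg j) Lpsi (cdphi j).
have c3 := cvgN c2.
rewrite -(cvg_lim (@Rhausdorff R) c1); apply: (cvg_lim (@Rhausdorff R)).
rewrite (_ : (fun n => _) = (fun n => - L2ip D ('D_(evec j) (phi n)) psi)); first exact: c3.
apply/funext => n; rewrite -[in RHS](L2ip_out D setT)//; last by move=> x; exact: test_fun_out (test_fun_derive _ _ j (tphi n)).
rewrite (test_fun_by_parts _ _ _ _ _ (tphi n) tpsi) opprK.
by rewrite (L2ip_out D setT)// => x; exact: test_fun_out (tphi n).
Qed.

Lemma test_fun_sum D K (F : 'I_K -> plane R -> R) : (forall k, test_fun D (F k)) ->
  test_fun D (\sum_(k < K) F k).
Proof. by move=> tF; elim/big_ind : _ => //; [exact: test_fun_0|exact: test_fun_add]. Qed.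

Definition lincomb K (c : 'I_K -> R) (u : 'I_K -> sobfun) : sobfun :=
  Sobfun (fun x => \sum_k c k * sval (u k) x) (fun j x => \sum_k c k * sgrad (u k) j x).

Lemma L2norm0 D : L2norm D (cst 0) = 0.
Proof. by rewrite L2normE ?L2ip0l ?sqrtr0//; exact: L2_0. Qed.

Lemma L2norm_sum_le D K (F : 'I_K -> plane R -> R) : (forall k, L2 D (F k)) ->
  L2norm D (fun x => \sum_k F k x) <= \sum_k L2norm D (F k).
Proof.
move=> HF; rewrite (_ : (fun x => _) = \sum_k F k); last by apply/funext => x; rewrite fct_sumE.
suff [] : L2norm D (\sum_k F k) <= \sum_k L2norm D (F k) /\ L2 D (\sum_k F k) by [].
elim/big_ind2 : _ => //; first by split; [rewrite L2norm0|exact: L2_0].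
move=> a f b g [fa Lf] [gb Lg]; split; last exact: L2D.
exact (le_trans (ler_L2normD D f g Lf Lg) (lerD fa gb)).
Qed.

Lemma cvg0_lincomb D K (c : 'I_K -> R) (phi : 'I_K -> nat -> plane R -> R) (f : 'I_K -> plane R -> R) :
  (forall k n, L2 D (phi k n)) -> (forall k, L2 D (f k)) ->
  (forall k, L2norm D (phi k n \- f k) @[n --> \oo] --> (0 : R)) ->
  L2norm D ((fun x => \sum_k c k * phi k n x) \- (fun x => \sum_k c k * f k x)) @[n --> \oo] --> (0 : R).
Proof.
move=> Lp Lf pf.
have L2d k n : L2 D (fun x => c k * (phi k n \- f k) x) by apply: L2Z; exact: L2B.
apply: (@squeeze_cvgr _ _ _ _ (cst 0) (fun n => \sum_k `|c k| * L2norm D (phi k n \- f k))).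
- near=> n; rewrite L2norm_ge0/=.
  rewrite (@eq_L2norm _ _ _ (fun x => \sum_k c k * (phi k n \- f k) x)); last first.
    by move=> x _ /=; rewrite -sumrB; apply: eq_bigr => k _; rewrite mulrBr.
  apply: (le_trans (L2norm_sum_le _ _ _ (fun k => L2d k n))).
  by apply: ler_sum => k _; rewrite L2normZ//; exact: L2B.
- exact: cvg_cst.
- have Z : 0 = \sum_(k < K) `|c k| * 0 :> R by rewrite big1// => k _; rewrite mulr0.
  rewrite (_ : (fun n => _) = \sum_(k < K) (fun n => `|c k| * L2norm D (phi k n \- f k))); last first.
    by apply/funext => n; rewrite fct_sumE.
  rewrite [X in _ --> X]Z; elim/big_ind2 : _ => [|g a h b ga hb|k _]; [exact: cvg_cst|exact: cvgD|].
  by apply: cvgM => //; exact: cvg_cst.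
Unshelve. all: by end_near. Qed.

Lemma H10_lincomb D K (c : 'I_K -> R) (u : 'I_K -> sobfun) : measurable (D : set (mplane R)) ->
  (forall k, H10 D (u k)) -> H10 D (lincomb K c u).
Proof.
move=> mD Hu.
have Lu k := (H10_L2 _ _ (Hu k)).1; have Lg k := (H10_L2 _ _ (Hu k)).2.
have /choice[phi Hphi] k : exists phi : nat -> plane R -> R,
    [/\ forall n, test_fun D (phi n),
        L2norm D (phi n \- sval (u k)) @[n --> \oo] --> (0 : R)
      & forall j, L2norm D ('D_(evec j) (phi n) \- sgrad (u k) j) @[n --> \oo]
                    --> (0 : R)] by case: (Hu k).
have tphi k n : test_fun D (phi k n) by case: (Hphi k).
have sumE (F : 'I_K -> plane R -> R) : (fun x => \sum_k c k * F k x) = \sum_k (fun x => c k * F k x).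
  by apply/funext => x; rewrite fct_sumE.
split.
  split; first by apply: L2_sum => k; exact: L2Z.
  move=> j; split; first by apply: L2_sum => k; exact: L2Z.
  move=> psi tpsi; rewrite /=.
  have Lpsi : L2 D psi by exact: test_fun_L2 tpsi.
  have Ldpsi : L2 D ('D_(evec j) psi) by exact: test_fun_L2 (test_fun_derive _ _ j tpsi).
  rewrite !L2ip_suml//; do ?[by move=> k; exact: L2Z].
  rewrite -sumrN; apply: eq_bigr => k _; rewrite !L2ipZl// -mulrN; congr (_ * _).
  by case: (Hu k) => [[_ /(_ j)[_ +]] _]; exact.
exists (fun n => fun x => \sum_k c k * phi k n x); split.
- by move=> n; rewrite sumE; apply: test_fun_sum => k; exact: test_fun_scale.
- apply: cvg0_lincomb => //; [by move=> k n; exact: test_fun_L2 (tphi k n)|by move=> k; case: (Hphi k)].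
- move=> j; rewrite (_ : (fun n => _) = (fun n => L2norm D ((fun x => \sum_k c k * 'D_(evec j) (phi k n) x) \-
    (fun x => \sum_k c k * sgrad (u k) j x)))); last first.
    apply/funext => n; congr (L2norm D (_ \- _)); apply/funext => x.
    rewrite sumE derive_sum; last by move=> k; apply: test_fun_derivable; exact: test_fun_scale.
    by apply: eq_bigr => k _; exact: (deriveZ _ (test_fun_derivable _ _ j x (tphi k n))).
  apply: cvg0_lincomb => //.
    by move=> k n; exact: test_fun_L2 (test_fun_derive _ _ j (tphi k n)).
  by move=> k; case: (Hphi k).
Qed.

(** The integral of the gradient is the limit of the integrals of the gradients of
test functions, which are 0. *)
Lemma H10_integral_grad D (u : sobfun) j : measurable (D : set (mplane R)) -> (mu D < +oo)%E ->
  H10 D u -> L2ip D (sgrad u j) (cst 1) = 0.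
Proof.
move=> mD fD Hu; have [Lu Lg] := H10_L2 _ _ Hu.
case: Hu => _ [phi [tphi _ cdphi]].
have L1D := L2_cst D 1 mD fD.
have Ldp n : L2 D ('D_(evec j) (phi n)) by exact: test_fun_L2 (test_fun_derive _ _ j (tphi n)).
have c2 := L2ip_cvg D _ _ _ Ldp (Lg j) L1D (cdphi j).
rewrite -(cvg_lim (@Rhausdorff R) c2); apply: (cvg_lim (@Rhausdorff R)).
rewrite (_ : (fun n => _) = cst 0); first exact: cvg_cst.
apply/funext => n /=; have [_ [A [cA _ A0]]] := tphi n.
rewrite -(L2ip_out D setT)//; last by move=> x; exact: test_fun_out (test_fun_derive _ _ j (tphi n)).
have [_] := integral_derive_eq0 A (phi n) j cA A0 (fun x => test_fun_derivable _ _ j x (tphi n))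
  (test_fun_continuous _ _ (test_fun_derive _ _ j (tphi n))).
by rewrite /L2ip => <-; apply: eq_Rintegral => x _; rewrite mulr1.
Qed.

(** The weak gradient [g] of a null function is orthogonal to all test functions, in
particular to the derivatives of the approximants of [u]; these converge to [g],
so [(g, g) = 0]. *)
Lemma H10_null_grad D (u : sobfun) j : measurable (D : set (mplane R)) ->
  H10 D u -> ae_eq mu D (sval u) (cst 0) -> L2norm D (sgrad u j) = 0.
Proof.
move=> mD Hu u0; have [Lu Lg] := H10_L2 _ _ Hu.
case: Hu => [[_ /(_ j)[_ wj]] [phi [tphi _ cdphi]]].
have Ldp n : L2 D ('D_(evec j) (phi n)) by exact: test_fun_L2 (test_fun_derive _ _ j (tphi n)).
have c2 := L2ip_cvg D _ _ _ Ldp (Lg j) (Lg j) (cdphi j).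
suff H : L2ip D (sgrad u j) (sgrad u j) = 0 by rewrite L2normE// H sqrtr0.
rewrite -(cvg_lim (@Rhausdorff R) c2); apply: (cvg_lim (@Rhausdorff R)).
rewrite (_ : (fun n => _) = cst 0); first exact: cvg_cst.
apply/funext => n /=; have := wj _ (test_fun_derive _ _ j (tphi n)).
have td := test_fun_derive _ _ j (test_fun_derive _ _ j (tphi n)).
rewrite (ae_eq_L2ip _ _ _ _ u0)//; [|exact: L2_0|exact: test_fun_L2 td].
by rewrite L2ip0l => /esym/eqP; rewrite oppr_eq0 L2ipC => /eqP.
Qed.

End TestFunctions.

(** * Splines and the local spaces *)

Section Splines.
Context {R : realType}.

Lemma near_unit_interval (t : R) : 0 < t < 1 -> \forall u \near t, 0 < u < 1.
Proof.
move=> t01; have : t \in `]0, 1[ by rewrite in_itv.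
by move/near_in_itvoo; apply: filterS => u; rewrite in_itv.
Qed.

(** Only the open interval matters: there each derivative of lower order exists. *)
Lemma derive1n_scale (f : R -> R) (a : R) (s : nat) :
  (forall j t, (j < s)%N -> 0 < t < 1 -> derivable (derive1n j f) t 1) ->
  forall j t, (j <= s)%N -> 0 < t < 1 ->
    derive1n j (fun u => a * f u) t = a * derive1n j f t.
Proof.
move=> df; elim=> [//|j IHj] t js t01.
rewrite !derive1nS !derive1E.
transitivity ('D_1 (a \*: derive1n j f) t); last exact: (deriveZ a (df j t js t01)).
apply: near_eq_derive; apply: filterS (near_unit_interval t t01) => u u01.
by rewrite IHj// ltnW.
Qed.

Lemma spline1_scale N (z : nat -> R) r s (f : R -> R) (a : R) :
  spline1 N z r s f -> spline1 N z r s (fun t => a * f t).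
Proof.
case=> cf df cdf pf; have E := derive1n_scale f a s df; split.
- by move=> t; apply: cvgM; [exact: cvg_cst|exact: cf].
- move=> j t js t01; apply: near_eq_derivable (derivableZ (k := a) (df j t js t01)).
  by apply: filterS (near_unit_interval t t01) => u u01; exact: esym (E _ _ (ltnW js) u01).
- move=> j t js t01.
  suff : derive1n j (fun u => a * f u) @ t --> derive1n j (fun u => a * f u) t by [].
  rewrite (E j t js t01).
  apply: cvg_trans (cvgM (cvg_cst a) (cdf j t js t01)).
  apply: near_eq_cvg.
  by apply: filterS (near_unit_interval t t01) => u u01; exact: esym (E _ _ js u01).
- move=> i iN; have [P sP fP] := pf i iN; exists (a *: P).
    exact: leq_trans (size_scale_leq _ _) sP.
  by move=> t zt; rewrite fP// hornerZ.
Qed.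

Lemma spline1_cst N (z : nat -> R) r s (c : R) : spline1 N z r s (fun=> c).
Proof.
have E j : exists c', derive1n j (fun=> c : R) = cst c'.
  elim: j => [|j [c' IHj]]; first by exists c.
  by exists 0; rewrite derive1nS IHj; apply/funext => t; rewrite derive1_cst.
split.
- by move=> t; exact: cvg_cst.
- by move=> j t _ _; have [c' ->] := E j; exact: derivable_cst.
- by move=> j t _ _; have [c' ->] := E j; exact: cvg_cst.
- move=> i iN; exists c%:P; last by move=> t _; rewrite hornerC.
  by rewrite (leq_trans (size_polyC_leq1 _)).
Qed.

(** The factor goes into the first univariate factor of each product. *)
Lemma spline2_scale N (z : 'I_2 -> nat -> R) r s (F : plane R -> R) (a : R) :
  spline2 N z r s F -> spline2 N z r s (fun x => a * F x).
Proof.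
move=> [m [f [sf FE]]].
exists m, (fun i d t => (if d == ord0 then a else 1) * f i d t); split.
  by move=> i d; exact: spline1_scale.
move=> x xsq; rewrite FE// mulr_sumr; apply: eq_bigr => i _.
by rewrite !big_ord_recl !big_ord0 /= !mul1r !mulrA.
Qed.

(** A constant is a spline, so [- c] is one more product of splines. *)
Lemma spline2_subc N (z : 'I_2 -> nat -> R) r s (F : plane R -> R) (c : R) :
  spline2 N z r s F -> spline2 N z r s (fun x => F x - c).
Proof.
move=> [m [f [sf FE]]].
exists m.+1, (fun i d => if unlift ord0 i is Some j then f j d
  else fun=> if d == ord0 then - c else 1); split.
  by move=> i d; case: unliftP => [j _|_]; [exact: sf|exact: spline1_cst].
move=> x xsq; rewrite FE// big_ord_recl addrC; congr (_ + _).
  by rewrite unlift_none !big_ord_recl big_ord0 /= !mulr1.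
by apply: eq_bigr => i _; rewrite liftK.
Qed.

End Splines.

Section LocalSpaces.
Context {R : realType} {K : nat}.
Variables (Om : set (plane R)) (G : 'I_K -> plane R -> plane R).
Variables (deg smo : nat).
Variables (N : 'I_K -> 'I_2 -> nat) (zeta : 'I_K -> 'I_2 -> nat -> R).

(** Membership in the local spaces is transported by pointwise operations. *)
Lemma pullback_is_comp k (v v' F F' : plane R -> R) (h : R -> R) :
  (forall x, subdom G k x -> v' x = h (v x)) -> (forall x, F' x = h (F x)) ->
  pullback_is G k v F -> pullback_is G k v' F'.
Proof.
move=> vE FE [w vw wF]; exists (h \o w); last by move=> a asq /=; rewrite wF// FE.
by apply: filterS vw => x /= vw Dx; rewrite vE// vw.
Qed.

Lemma Vloc_scale k (a : R) (v v' : vfield) :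
  (forall c x, subdom G k x -> sval (v' c) x = a * sval (v c) x) ->
  Vloc Om G deg smo N zeta k v -> Vloc Om G deg smo N zeta k v'.
Proof.
move=> vE Vv c; have [F [sF pF F0]] := Vv c.
exists (fun x => a * F x); split; first exact: spline2_scale.
  exact: (@pullback_is_comp k _ _ _ _ (fun y => a * y) (vE c) _ pF).
by move=> x xsq bx; rewrite F0// mulr0.
Qed.

Lemma Qloc_subc k (c : R) (q q' : plane R -> R) :
  (forall x, subdom G k x -> q' x = q x - c) ->
  Qloc G deg smo N zeta k q -> Qloc G deg smo N zeta k q'.
Proof.
move=> qE [F sF pF]; exists (fun x => F x - c); first exact: spline2_subc.
exact: (@pullback_is_comp k _ _ _ _ (fun y => y - c) qE _ pF).
Qed.

End LocalSpaces.

(** * The divergence form *)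

Section Divergence.
Context {R : realType}.
Local Notation mu := (leb2 R).
Variable D : set (plane R).
Hypothesis mD : measurable (D : set (mplane R)).
Implicit Types (u v : @vfield R) (q : plane R -> R).

Lemma vH10_grad_L2 u c j : vH10 D u -> L2 D (sgrad (u c) j).
Proof. by move=> /(_ c) /H10_L2[]. Qed.

Lemma divg_L2 u : vH10 D u -> L2 D (divg u).
Proof. by move=> Hu; apply: L2_sum => c; exact: vH10_grad_L2. Qed.

Lemma H1semi_ge0 u : 0 <= H1semi D u.
Proof. exact: sqrtr_ge0. Qed.

Lemma sqr_H1semi u : H1semi D u ^+ 2 = \sum_(c < 2) \sum_(j < 2) L2norm D (sgrad (u c) j) ^+ 2.
Proof.
rewrite sqr_sqrtr//; apply: sumr_ge0 => c _; apply: sumr_ge0 => j _; exact: sqr_ge0.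
Qed.

(** [(a + b)^2 <= 2 (a^2 + b^2)] applied to the two diagonal entries of the gradient. *)
Lemma L2norm_divg_le u : vH10 D u -> L2norm D (divg u) <= Num.sqrt 2 * H1semi D u.
Proof.
move=> Hu; apply: le_trans (L2norm_sum_le _ _ _ (fun c => vH10_grad_L2 u c c Hu)) _.
rewrite -(ler_pXn2r (n := 2))// ?nnegrE ?mulr_ge0 ?sqrtr_ge0//; last first.
  by apply: sumr_ge0 => c _; exact: L2norm_ge0.
rewrite exprMn sqr_sqrtr// sqr_H1semi !big_ord_recl !big_ord0 !addr0.
set a := L2norm _ _; set b := L2norm _ _; set c := L2norm _ _; set d := L2norm _ _.
have := sqr_ge0 (a - b); have := sqr_ge0 c; have := sqr_ge0 d; nra.
Qed.

Lemma divg_ip_le u q : vH10 D u -> L2 D q ->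
  `|L2ip D (divg u) q| <= Num.sqrt 2 * H1semi D u * L2norm D q.
Proof.
move=> Hu Hq; apply: le_trans (normr_L2ip_le _ _ _ (divg_L2 u Hu) Hq) _.
by apply: ler_wpM2r; [exact: L2norm_ge0|exact: L2norm_divg_le].
Qed.

Lemma divg_ip_eq0 u q : vH10 D u -> L2 D q -> H1semi D u * L2norm D q = 0 ->
  L2ip D (divg u) q = 0.
Proof.
move=> Hu Hq z; apply/eqP; rewrite -normr_le0 (le_trans (divg_ip_le u q Hu Hq))//.
by rewrite -mulrA z mulr0.
Qed.

Lemma vnull_H1semi u : vH10 D u -> vnull D u -> H1semi D u = 0.
Proof.
move=> Hu nu; rewrite /H1semi big1 ?sqrtr0// => c _; apply: big1 => j _.
by rewrite (H10_null_grad _ _ _ mD (Hu c) (nu c)) expr0n.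
Qed.

(** The suprema range over fields that are not null. A field whose divergence has a
nonzero inner product with some function qualifies by this lemma. *)
Lemma vnull_divg u q : vH10 D u -> L2 D q -> vnull D u -> L2ip D (divg u) q = 0.
Proof. by move=> Hu Hq nu; rewrite divg_ip_eq0// (vnull_H1semi u Hu nu) mul0r. Qed.

Lemma integral_divg u : (mu D < +oo)%E -> vH10 D u -> L2ip D (divg u) (cst 1) = 0.
Proof.
move=> fD Hu; rewrite L2ip_suml; [|by move=> c; exact: vH10_grad_L2|exact: L2_cst].
by rewrite big1// => c _; exact: H10_integral_grad (Hu c).
Qed.

End Divergence.

Lemma Rintegral_L2ip1 {R : realType} (D : set (plane R)) (f : plane R -> R) :
  \int[leb2 R]_(x in D) f x = L2ip D f (cst 1).
Proof. by apply: eq_Rintegral => x _; rewrite mulr1. Qed.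

(** * Gluing fields that live on the patches *)

Section Glue.
Context {R : realType} {K : nat}.
Local Notation mu := (leb2 R).
Variables (Om : set (plane R)) (P : 'I_K -> set (plane R)).
Hypothesis mOm : measurable (Om : set (mplane R)).
Hypothesis mP : forall k, measurable (P k : set (mplane R)).
Hypothesis POm : forall k, P k `<=` Om.
Hypothesis Pdis : forall k l, k != l -> P k `&` P l = set0.
Hypothesis Pnull : mu.-negligible (Om `\` \bigcup_k P k : set (mplane R)).
Implicit Types (c : 'I_K -> R) (u : 'I_K -> @vfield R).

(** The field which is [c k] times [u k] on the patch [P k]. *)
Definition glue c u : vfield := fun i => lincomb K c (fun k => ext0 (P k) (u k i)).

Lemma sum_ext0 c (f : 'I_K -> plane R -> R) k x : P k x ->
  \sum_l c l * (f l \_ (P l)) x = c k * f k x.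
Proof.
move=> Px; rewrite (bigD1 k)//= patchE mem_set// big1 ?addr0// => l lk.
rewrite patchE; case: ifPn => [/set_mem Plx|]; last by rewrite mulr0.
by have /seteqP[+ _] := Pdis l k lk => /(_ x) [].
Qed.

Lemma glue_val c u k i x : P k x -> sval (glue c u i) x = c k * sval (u k i) x.
Proof. exact: sum_ext0. Qed.

Lemma glue_grad c u k i j x : P k x -> sgrad (glue c u i) j x = c k * sgrad (u k i) j x.
Proof. exact: sum_ext0. Qed.

Lemma glue_divg c u k x : P k x -> divg (glue c u) x = c k * divg (u k) x.
Proof.
by move=> Px; rewrite /divg mulr_sumr; apply: eq_bigr => i _; rewrite (glue_grad c u k).
Qed.

Lemma glue_H10 c u : (forall k, vH10 (P k) (u k)) -> vH10 Om (glue c u).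
Proof. by move=> Hu i; apply: H10_lincomb => // k; apply: H10_ext0 => //; exact: Hu. Qed.

Lemma sqr_L2norm_partition f : L2 Om f -> L2norm Om f ^+ 2 = \sum_k L2norm (P k) f ^+ 2.
Proof.
move=> Hf; rewrite sqr_L2norm// (L2ip_partition _ _ P)//.
by apply: eq_bigr => k _; rewrite sqr_L2norm//; exact: L2_sub Hf.
Qed.

(** The pieces have disjoint supports, so the squared seminorms add up. *)
Lemma glue_H1semi c u : (forall k, vH10 (P k) (u k)) ->
  H1semi Om (glue c u) ^+ 2 = \sum_k (c k * H1semi (P k) (u k)) ^+ 2.
Proof.
move=> Hu; rewrite sqr_H1semi.
transitivity (\sum_(i < 2) \sum_k \sum_(j < 2) L2norm (P k) (sgrad (glue c u i) j) ^+ 2).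
  apply: eq_bigr => i _; rewrite exchange_big; apply: eq_bigr => j _.
  by apply: sqr_L2norm_partition; exact: vH10_grad_L2 (glue_H10 c u Hu).
rewrite exchange_big/=; apply: eq_bigr => k _.
rewrite exprMn sqr_H1semi mulr_sumr; apply: eq_bigr => i _.
rewrite mulr_sumr; apply: eq_bigr => j _.
rewrite (@eq_L2norm _ _ _ (fun x => c k * sgrad (u k i) j x)); last first.
  by move=> x; exact: glue_grad.
by rewrite L2normZ ?exprMn ?sqr_normr ?real_normK ?num_real//; exact: vH10_grad_L2.
Qed.

Lemma glue_divg_ip c u q : (forall k, vH10 (P k) (u k)) -> L2 Om q ->
  L2ip Om (divg (glue c u)) q = \sum_k c k * L2ip (P k) (divg (u k)) q.
Proof.
move=> Hu Hq; rewrite (L2ip_partition _ _ P)//; last by apply: divg_L2; exact: glue_H10.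
apply: eq_bigr => k _; rewrite -L2ipZl; [|exact: divg_L2|exact: L2_sub Hq].
by apply: eq_L2ip => // x; exact: glue_divg.
Qed.

End Glue.

Section Geometry.
Context {R : realType} {K : nat}.
Local Notation mu := (leb2 R).
Variables (Om : set (plane R)) (G : 'I_K -> plane R -> plane R).
Hypothesis dom : multipatch_domain Om G.

(** What the patches miss lies on their boundaries. *)
Lemma patches_negligible :
  mu.-negligible (Om `\` \bigcup_k subdom G k : set (mplane R)).
Proof.
case: dom => _ [_ _ oP _ clOm].
pose B n : set (mplane R) := if insub n is Some k then boundary (subdom G k) else set0.
apply: (@negligibleS _ _ _ _ (\bigcup_n B n)); last first.
  apply: negligible_bigcup => n; rewrite /B; case: insubP => [k _ _|_]; last exact: negligible_set0.
  by have [_ bP lP _] := oP k; exact: lipschitz_boundary_negligible.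
move=> x [Omx nPx]; have : closure Om x by exact: subset_closure.
rewrite clOm => -[k _ clk]; exists (k : nat) => //; rewrite /B valK.
by split => // /interior_subset Px; apply: nPx; exists k.
Qed.

Lemma patch_exists : exists k : 'I_K, True.
Proof.
case: dom => -[_ _ _ [x Omx] _] [_ _ _ _ clOm].
by have := subset_closure Omx; rewrite clOm => -[k _ _]; exists k.
Qed.

Lemma patch_measure_gt0 k : (0 < mu (subdom G k))%E.
Proof.
case: dom => _ [_ _ oP _ _]; have [oPk _ _ _] := oP k.
apply: open_measure_gt0 => //; exists (G k (2^-1, 2^-1)), (2^-1, 2^-1) => //.
by split; rewrite /=; apply/andP; split; rewrite ?invr_gt0 ?invf_lt1 ?ltr1n.
Qed.

End Geometry.

(** * The discrete inf-sup condition *)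

(** Suprema need not be attained: near-maximisers give all bounds with a factor
[th < 1]. *)
Lemma le_of_fractions {R : realType} (x y : R) (S : \bar R) : 0 <= x ->
  (forall th : R, 0 < th < 1 -> ((th * x - y)%:E <= S)%E) -> ((x - y)%:E <= S)%E.
Proof.
move=> x0 H; apply/lee_addgt0Pr => e e0.
(* [th = (x + e) / (x + 2 e)] loses at most [e] from [x], also when [x = 0] *)
have d0 : 0 < x + 2 * e by lra.
have th01 : 0 < (x + e) / (x + 2 * e) < 1 by rewrite divr_gt0/= ?ltr_pdivrMr ?mul1r; lra.
apply: le_trans (leeD (H _ th01) (lexx e%:E)); rewrite -EFinD lee_fin.
have -> : (x + e) / (x + 2 * e) * x = x - e * (x / (x + 2 * e)).
  by field; rewrite gt_eqF.
have : x / (x + 2 * e) <= 1 by rewrite ler_pdivrMr// mul1r; lra.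
nra.
Qed.

(** If [S >= Bm a] and [S >= (beta / cF) b - delta a], then
[beta b <= cF (S + delta a)] and [Bm a <= S] give
[beta Bm (a + b) <= (beta + cF Bm + cF delta) S <= 3 cF delta S]. *)
Lemma inf_sup_combine {R : realType} (S : \bar R) (Bm beta cF delta a b n : R) :
  0 <= Bm -> Bm <= delta -> 0 < beta -> beta <= delta -> 1 <= cF -> 0 <= a -> 0 <= b -> n <= a + b ->
  ((Bm * a)%:E <= S)%E -> ((beta / cF * b - delta * a)%:E <= S)%E ->
  ((beta * Bm / (3 * cF * delta) * n)%:E <= S)%E.
Proof.
move=> Bm0 Bmd b0 bd cF1 a0 bb0 nab; case: S => [s| |]; rewrite ?leey//.
rewrite !lee_fin => h1 h2.
have cF0 : 0 < cF by lra.
have d0 : 0 < delta by lra.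
have h3 : beta * b <= cF * (s + delta * a).
  have : beta / cF * b <= s + delta * a by lra.
  by rewrite -(ler_pM2l cF0) (_ : cF * (beta / cF * b) = beta * b)//; field; rewrite gt_eqF.
have s0 : 0 <= s by apply: le_trans h1; exact: mulr_ge0.
have den : 0 < 3 * cF * delta by rewrite !mulr_gt0.
rewrite mulrAC ler_pdivrMr//.
have k0 : beta * Bm * n <= beta * Bm * (a + b) by rewrite ler_wpM2l// mulr_ge0// ltW.
have k1 : beta * (Bm * a) <= beta * s by rewrite ler_wpM2l// ltW.
have k2 : Bm * (beta * b) <= Bm * (cF * (s + delta * a)) by rewrite ler_wpM2l.
have k3 : cF * delta * (Bm * a) <= cF * delta * s by rewrite ler_wpM2l// mulr_ge0// ltW.
have k4 : Bm * (cF * s) <= delta * (cF * s) by rewrite ler_wpM2r// mulr_ge0// ltW.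
have k5 : beta * s <= delta * s by rewrite ler_wpM2r.
have k6 : delta * s <= cF * (delta * s) by rewrite ler_peMl// mulr_ge0// ltW.
lra.
Qed.

(** A near-maximiser has a positive quotient, which forces [nrm u] to be positive
because a quotient by 0 is 0. *)
Lemma sup_witness {R : realType} (D : set (plane R)) (W : set vfield) (nrm : vfield -> R) q
    (b c th : R) : (forall u, 0 <= nrm u) ->
  0 < b -> 0 < c -> 0 < th < 1 -> ((b * c)%:E <= div_sup D W nrm q)%E ->
  exists u, [/\ W u, 0 < nrm u & th * (b * c) * nrm u <= L2ip D (divg u) q].
Proof.
move=> nrm0 b0 c0 /andP[th0 th1] H.
have lt : ((th * (b * c))%:E < div_sup D W nrm q)%E.
  by apply: lt_le_trans H; rewrite lte_fin gtr_pMl// mulr_gt0.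
have [_ [u [Wu _] <-]] := ereal_sup_gt lt; rewrite lte_fin => H1.
have n0 : 0 < nrm u.
  rewrite lt0r nrm0 andbT; apply: contraTneq H1 => ->.
  by rewrite invr0 mulr0 -leNgt !mulr_ge0// ltW.
by exists u; split => //; rewrite -ler_pdivlMr// ltW.
Qed.

(** The supremum over the empty set is [-oo]. *)
Lemma sup_nonempty {R : realType} (D : set (plane R)) (W : set vfield) (nrm : vfield -> R) q
    (b : R) : (b%:E <= div_sup D W nrm q)%E -> exists u, W u /\ ~ vnull D u.
Proof.
move=> H.
have lt : ((b - 1)%:E < div_sup D W nrm q)%E.
  by apply: lt_le_trans H; rewrite lte_fin gtrBl.
by have [_ [u [Wu nu] _] _] := ereal_sup_gt lt; exists u.
Qed.

Lemma div_sup_ge {R : realType} (D : set (plane R)) (W : set vfield) (nrm : vfield -> R) q u (x : R) :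
  W u -> ~ vnull D u -> x <= L2ip D (divg u) q / nrm u -> (x%:E <= div_sup D W nrm q)%E.
Proof.
move=> Wu nu xq; apply: (@le_trans _ _ (L2ip D (divg u) q / nrm u)%:E); first by rewrite lee_fin.
by apply: ereal_sup_ubound; exists u.
Qed.

Theorem theorem3p1 (R : realType) (K : nat)
    (Om : set (plane R)) (G : 'I_K -> plane R -> plane R)
    (C2 C3 C4 C5 : R) (deg smo : nat)
    (N : 'I_K -> 'I_2 -> nat) (zeta : 'I_K -> 'I_2 -> nat -> R)
    (beta cF : R) (betak : 'I_K -> R) (delta : R)
    (domain : multipatch_domain Om G)
    (A1 : no_hanging_vertices G)
    (A2 : bounded_valence Om G C2)
    (A3 : regular_maps G C3)
    (C4_gt0 : 0 < C4) (A4 : normals_aligned G C4)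
    (deg_ge1 : (1 <= deg)%N) (smo_le : (smo <= deg.-1)%N)
    (mesh : forall k d, breakpoints (N k d) (zeta k d))
    (C5_gt0 : 0 < C5) (A5 : quasi_uniform N zeta C5)
    (A6 : fully_matching Om G deg smo N zeta)
    (delta_def : delta = Num.sqrt 2)
    (beta_gt0 : 0 < beta)
    (beta_infsup : forall p, L20 Om p ->
      ((beta * L2norm Om p)%:E <= div_sup Om (vH10 Om) (H1norm Om) p)%E)
    (betak_gt0 : forall k, 0 < betak k)
    (betak_infsup : forall k p,
      Qloc G deg smo N zeta k p -> L20 (subdom G k) p ->
      ((betak k * L2norm (subdom G k) p)%:E <=
       div_sup (subdom G k) (Vloc Om G deg smo N zeta k `&` vH10 (subdom G k))
         (H1semi (subdom G k)) p)%E)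
    (beta_le : beta <= delta) (betak_le : forall k, betak k <= delta)
    (cF_ge1 : 1 <= cF)
    (fortin : exists PiF, fortin_operator Om G deg smo N zeta cF PiF) :
  forall p, Qglob Om G deg smo N zeta p ->
    ((beta * inf (range betak) / (3 * cF * delta) * L2norm Om p)%:E <=
     div_sup Om (Vglob Om G deg smo N zeta) (H1semi Om) p)%E.
Proof.
move=> p [[Lp intp] Qp].
pose P k := subdom G k.
have [[oOm bOm _ _ _] [_ _ HP Pdis _]] := domain.
have mOm := open_measurable_plane Om oOm.
have mP k : measurable (P k : set (mplane R)).
  by apply: open_measurable_plane; case: (HP k).
have POm k : P k `<=` Om by case: (HP k).
have fP k : ((leb2 R) (P k) < +oo)%E by apply: bounded_measure_fin => //; case: (HP k).
have fOm := bounded_measure_fin Om bOm mOm.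
have Pnull := patches_negligible Om G domain.
have [k0 _] := patch_exists Om G domain.
have L1P k c : L2 (P k) (cst c) by exact: L2_cst.
(* [p1] is the patchwise mean of [p] and [p0] the fluctuation around it *)
pose area k := fine ((leb2 R) (P k)).
have area_gt0 k : 0 < area k by rewrite fine_gt0// fP (patch_measure_gt0 Om G domain).
have area_ip k c : L2ip (P k) (cst c) (cst 1) = c * area k.
  by rewrite -Rintegral_L2ip1 Rintegral_cst.
pose m k := L2ip (P k) p (cst 1) / area k.
pose p1 : plane R -> R := fun x => \sum_k m k * ((cst 1 : plane R -> R) \_ (P k)) x.
pose p0 := p \- p1.
have p1E k x : P k x -> p1 x = m k.
  by move=> Px; rewrite /p1 (sum_ext0 P Pdis m (fun=> cst 1) k x Px) mulr1.
have p0E k x : P k x -> p0 x = p x - m k by move=> Px; rewrite /p0 /= (p1E k).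
have Lp1 : L2 Om p1 by apply: L2_sum => k; apply: L2Z; apply/L2_ext.
have Lp0 : L2 Om p0 by exact: L2B.
have Lpk k : L2 (P k) p by exact: L2_sub Lp.
have Lp0k k : L2 (P k) p0 by exact: L2_sub Lp0.
have p1_mean : L20 Om p1.
  split => //; transitivity (\int[leb2 R]_(x in Om) p x) => //.
  rewrite !Rintegral_L2ip1 !(L2ip_partition _ Om P)//; do ?exact: L2_cst.
  apply: eq_bigr => k _; rewrite (@eq_L2ip _ _ _ _ (cst (m k)) (cst 1))// ?area_ip.
    by rewrite /m divfK// gt_eqF.
  by move=> x; exact: p1E.
have p1_Q1 : Q1 Om G p1.
  by split => // k; exists (m k); apply/nearW => x; exact: p1E.
have p0_Q k : Qloc G deg smo N zeta k p0.
  by apply: (@Qloc_subc _ _ _ _ _ _ _ _ (m k) _ _ _ (Qp k)) => x; exact: p0E.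
have p0_mean k : L20 (subdom G k) p0.
  split; first exact: Lp0k.
  rewrite Rintegral_L2ip1 (@eq_L2ip _ _ _ _ (p \- cst (m k)) (cst 1))//; last by move=> x; exact: p0E.
  rewrite L2ipBl; [|exact: Lpk|exact: L1P|exact: L1P].
  by rewrite area_ip /m divfK ?subrr// gt_eqF.
set a := L2norm Om p0; set b := L2norm Om p1.
have ak_ge0 k : 0 <= L2norm (P k) p0 by exact: L2norm_ge0.
have nab : L2norm Om p <= a + b.
  rewrite (_ : p = p0 \+ p1); last by apply/funext => x; rewrite /p0 /= subrK.
  exact: ler_L2normD.
set Bm := inf (range betak).
have Bm_le k : Bm <= betak k by apply: ge_inf; [exists 0 => _ [l _ <-]; exact: ltW|exists k].
have Bm_gt0 : 0 < Bm.
  have [kmin _ Hmin] := @arg_minP _ _ _ k0 xpredT betak isT.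
  apply: lt_le_trans (betak_gt0 kmin) _; apply: lb_le_inf; first by exists (betak k0), k0.
  by move=> _ [l _ <-]; exact: Hmin.
have Bm_ge0 := ltW Bm_gt0.
have Bm_d : Bm <= delta by exact: le_trans (Bm_le k0) (betak_le k0).
set S := div_sup _ _ _ _.
(* a field of H^1_0 of a patch has a divergence of mean 0, hence orthogonal to [p1] *)
have divk_p0 k u : vH10 (P k) u -> L2ip (P k) (divg u) p = L2ip (P k) (divg u) p0.
  move=> Hu; have Lu := divg_L2 (P k) u Hu.
  rewrite [RHS](@eq_L2ip _ _ _ _ (divg u) (p \- (fun x => m k * (cst 1 : plane R -> R) x)))//; last first.
    by move=> x Px; rewrite (p0E k)//= mulr1.
  rewrite L2ipBr//; last exact: L2Z.
  by rewrite L2ipZr// integral_divg// mulr0 subr0.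
have glue_V c u : (forall k, (Vloc Om G deg smo N zeta k `&` vH10 (P k)) (u k)) ->
    Vglob Om G deg smo N zeta (glue P c u).
  move=> Hu; split; first by apply: glue_H10 => // k; case: (Hu k).
  move=> k; apply: (@Vloc_scale _ _ _ _ _ _ _ _ _ (c k) (u k)); last by case: (Hu k).
  by move=> i x; exact: glue_val.
have glue_ip c u : (forall k, vH10 (P k) (u k)) ->
    L2ip Om (divg (glue P c u)) p = \sum_k c k * L2ip (P k) (divg (u k)) p0.
  by move=> Hu; rewrite glue_divg_ip//; apply: eq_bigr => k _; rewrite divk_p0.
have delta_gt0 : 0 < delta by exact: lt_le_trans beta_gt0 beta_le.
(* testing with glued near-maximisers of the local quotients *)
have Sa : ((Bm * a)%:E <= S)%E.
  have a_ge0 : 0 <= a by exact: L2norm_ge0.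
  have a_sum : a ^+ 2 = \sum_k L2norm (P k) p0 ^+ 2 by exact: sqr_L2norm_partition.
  have Wne k : exists u, (Vloc Om G deg smo N zeta k `&` vH10 (P k)) u /\ ~ vnull (P k) u.
    by have := betak_infsup k p0 (p0_Q k) (p0_mean k); exact: sup_nonempty.
  (* if [p0] is null the bound is 0, and a field that lives on one patch attains it *)
  have [a0|a_neq0] := eqVneq a 0.
    have /choice[u Hu] := Wne.
    pose c (k : 'I_K) : R := (k == k0)%:R.
    apply: (div_sup_ge _ _ _ _ (glue P c u)); first by apply: glue_V => k; case: (Hu k).
      move=> nu; have [_] := Hu k0; apply => i; have := nu i.
      apply: filterS => x /= vx Px; have := vx (POm k0 _ Px).
      by rewrite (sum_ext0 P Pdis c (fun k => sval (u k i)) k0 x Px) /c eqxx mul1r.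
    rewrite a0 mulr0 glue_ip; last by move=> k; case: (Hu k) => -[].
    rewrite big1 ?mul0r// => k _; rewrite divg_ip_eq0 ?mulr0//; first by case: (Hu k) => -[].
    have : L2norm (P k) p0 ^+ 2 <= a ^+ 2.
      by rewrite a_sum (bigD1 k)//= lerDl sumr_ge0// => l _; exact: sqr_ge0.
    rewrite a0 expr0n/= => h; have : L2norm (P k) p0 = 0.
      by apply/eqP; rewrite -sqrf_eq0 eq_le h sqr_ge0.
    by move=> ->; rewrite mulr0.
  have a_gt0 : 0 < a by rewrite lt0r a_neq0.
  rewrite -[Bm * a]subr0; apply: le_of_fractions; first exact: mulr_ge0.
  move=> th th01; have /andP[th0 th1] := th01; rewrite subr0.
  (* scale the local field to have the norm of [p0] on the patch as seminorm *)
  have /choice[cu Hcu] k : exists cu : R * vfield,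
      [/\ (Vloc Om G deg smo N zeta k `&` vH10 (P k)) cu.2,
          cu.1 * H1semi (P k) cu.2 = L2norm (P k) p0 &
          th * Bm * L2norm (P k) p0 ^+ 2 <= cu.1 * L2ip (P k) (divg cu.2) p0].
    have [ak0|ak_neq0] := eqVneq (L2norm (P k) p0) 0.
      have [u [Wu _]] := Wne k; exists (0, u); split => //=; rewrite ?mul0r ?ak0//.
      by rewrite expr0n/= mulr0.
    have ak_gt0 : 0 < L2norm (P k) p0 by rewrite lt0r ak_neq0 ak_ge0.
    have [u [Wu su Hu]] := sup_witness _ _ _ _ _ _ _ (H1semi_ge0 (P k)) (betak_gt0 k) ak_gt0 th01
      (betak_infsup k p0 (p0_Q k) (p0_mean k)).
    exists (L2norm (P k) p0 / H1semi (P k) u, u); split => //=; first by rewrite divfK// gt_eqF.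
    set s := H1semi (P k) u in su Hu *; set A := L2norm (P k) p0 in ak_gt0 Hu *.
    apply: (@le_trans _ _ (A / s * (th * (betak k * A) * s))); last first.
      by rewrite ler_wpM2l// divr_ge0// ltW.
    have -> : A / s * (th * (betak k * A) * s) = th * betak k * A ^+ 2 by field; rewrite gt_eqF.
    by rewrite ler_wpM2r ?sqr_ge0// ler_wpM2l// ltW.
  pose c k := (cu k).1; pose u k := (cu k).2.
  have Wu k : (Vloc Om G deg smo N zeta k `&` vH10 (P k)) (u k) by case: (Hcu k).
  have Hu k : vH10 (P k) (u k) by case: (Wu k).
  have semi : H1semi Om (glue P c u) = a.
    apply/eqP; rewrite -(eqrXn2 (n := 2))//; last exact: H1semi_ge0.
    rewrite (glue_H1semi Om P)// a_sum; apply/eqP; apply: eq_bigr => k _.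
    by case: (Hcu k) => _ ->.
  have ip : th * Bm * a ^+ 2 <= L2ip Om (divg (glue P c u)) p.
    by rewrite glue_ip// a_sum mulr_sumr; apply: ler_sum => k _; case: (Hcu k).
  have ip_gt0 : 0 < L2ip Om (divg (glue P c u)) p.
    by apply: lt_le_trans ip; rewrite !mulr_gt0// exprn_gt0.
  apply: (div_sup_ge _ _ _ _ (glue P c u)); first exact: glue_V.
    by move=> nu; move: ip_gt0; rewrite vnull_divg ?ltxx//; exact: glue_H10.
  rewrite semi ler_pdivlMr//; apply: le_trans ip.
  by rewrite expr2 !mulrA.
(* testing with the projection into the discrete space of a near-maximiser for [p1] *)
have Sb : ((beta / cF * b - delta * a)%:E <= S)%E.
  have b_ge0 : 0 <= b by exact: L2norm_ge0.
  have cF_gt0 : 0 < cF by exact: lt_le_trans cF_ge1.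
  have [b0|b_neq0] := eqVneq b 0.
    apply: le_trans Sa; rewrite lee_fin b0 mulr0 sub0r.
    apply: (@le_trans _ _ 0); last by rewrite mulr_ge0// L2norm_ge0.
    by rewrite oppr_le0 mulr_ge0 ?L2norm_ge0 ?ltW.
  have b_gt0 : 0 < b by rewrite lt0r b_neq0.
  apply: le_of_fractions; first by rewrite mulr_ge0// divr_ge0 ?ltW.
  move=> th th01; have /andP[th0 th1] := th01.
  have H1norm_ge0 u : 0 <= H1norm Om u by exact: sqrtr_ge0.
  have [u [Hu nu ip]] := sup_witness _ _ _ _ _ _ _ H1norm_ge0 beta_gt0 b_gt0 th01 (beta_infsup p1 p1_mean).
  have [PiF [_ /(_ u Hu)[VPi semiPi ortho]]] := fortin.
  set w := PiF u in VPi semiPi ortho.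
  have Hw : vH10 Om w by case: VPi.
  have ipw : L2ip Om (divg w) p1 = L2ip Om (divg u) p1.
    apply/esym/eqP; rewrite -subr_eq0 -L2ipBl//; do ?exact: divg_L2.
    rewrite -(ortho p1 p1_Q1); apply/eqP; apply: eq_L2ip => // x _.
    by rewrite /divg /= sumrB.
  set X := L2ip Om (divg w) p1 in ipw.
  rewrite -ipw in ip.
  have X_gt0 : 0 < X by apply: lt_le_trans ip; rewrite !mulr_gt0.
  set h := H1semi Om w in semiPi.
  have h_gt0 : 0 < h.
    rewrite lt0r (H1semi_ge0 Om w) andbT; apply: contraTneq X_gt0 => h0.
    by rewrite /X divg_ip_eq0 ?ltxx// -/h h0 mul0r.
  have hn : h <= cF * H1norm Om u.
    apply: le_trans semiPi _; rewrite (ler_wpM2l (ltW cF_gt0))// -(ler_pXn2r (n := 2))// ?nnegrE ?H1semi_ge0//.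
    rewrite [leRHS]sqr_sqrtr; first by rewrite lerDr sumr_ge0// => i _; exact: sqr_ge0.
    by rewrite addr_ge0 ?sqr_ge0// sumr_ge0// => i _; exact: sqr_ge0.
  apply: (div_sup_ge _ _ _ _ w) => //.
    by move=> nuw; move: X_gt0; rewrite /X vnull_divg ?ltxx.
  have -> : L2ip Om (divg w) p = L2ip Om (divg w) p0 + X.
    rewrite -L2ipDr//; last exact: divg_L2.
    by apply: eq_L2ip => // x _; rewrite /p0 /= subrK.
  rewrite ler_pdivlMr//.
  have := divg_ip_le Om w p0 Hw Lp0; rewrite -delta_def -/h -/a ler_norml => /andP[low _].
  have : th * (beta / cF * b) * h <= X.
    have -> : th * (beta / cF * b) * h = th * (beta * b) * (h / cF) by field; rewrite gt_eqF.
    apply: le_trans ip; apply: ler_wpM2l; first by rewrite !mulr_ge0// ltW.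
    by rewrite ler_pdivrMr// mulrC.
  lra.
by apply: inf_sup_combine Sa Sb => //; rewrite ?L2norm_ge0.
Qed.
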